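(* Let $L=\{(q,p)\in\mathbb R^{2n}: p=dS(q)\}$ locally near $0\in L$, for a smooth function-germ $S$ at $0\in\mathbb R^n$ (real analytic in the special case). Put $$G_{cc}^s(\beta,q,p)=\tfrac12\big(S(q+\beta)-S(q-\beta)\big)-p\cdot\beta ,\qquad G_{sp}^s(\beta,q,p)=Q(q,\beta)-p\cdot\beta ,$$ where, in the special case, $H$ is the holomorphic extension of $S$ near $0\in\mathbb C^n$ and $Q(s,t)=\operatorname{Im}H(s+it)$ (so that $L=\{(s,\frac{\partial Q}{\partial t}(s,0))\}$). (a) The germ at $0\in L$ of $\mathcal E_{cc}^s(L)$ (resp. $\mathcal E_{sp}^s(L)$) is the set of critical values of the Lagrangian map-germ $\pi|_{\mathcal L}:\mathcal L\to\mathbb R^{2n}$, where $\mathcal L$ is the Lagrangian submanifold-germ of $(T\mathbb R^{2n},\Omega)$ determined by the generating family $G=G_{cc}^s$ (resp. $G=G_{sp}^s$), i.e. $$\mathcal L=\Big\{(q,p,\dot q,\dot p):\ \exists\,\beta:\ \tfrac{\partial G}{\partial\beta}=0,\ \tfrac{\partial G}{\partial q}=\dot p,\ -\tfrac{\partial G}{\partial p}=\dot q\Big\}.$$ (b) The germ at $0\in L\times\{0\}$ of $\tilde{\mathcal E}_{cc}^s(L)$ (resp. $\tilde{\mathcal E}_{sp}^s(L)$) is the set of critical values of the Legendrian map-germ $\tilde\pi|_{\tilde{\mathcal L}}:\tilde{\mathcal L}\to\mathbb R^{2n}\times\mathbb R$, where $\tilde{\mathcal L}$ is the Legendrian submanifold-germ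 of $(T\mathbb R^{2n}\times\mathbb R,\{\theta=0\})$ determined by $G=G_{cc}^s$ (resp. $G=G_{sp}^s$), i.e. $$\tilde{\mathcal L}=\Big\{(q,p,\dot q,\dot p,z):\ \exists\,\beta:\ \tfrac{\partial G}{\partial\beta}=0,\ \tfrac{\partial G}{\partial q}=\dot p,\ -\tfrac{\partial G}{\partial p}=\dot q,\ z=G(\beta,q,p)\Big\}.$$
   Context: Coordinates: $x=(q,p)\in\mathbb R^{2n}$, $y=(\dot q,\dot p)$; $\omega=\sum_i dq_i\wedge dp_i$ on $\mathbb R^{2n}$. $\pi:T\mathbb R^{2n}\to\mathbb R^{2n}$, $\pi(x,y)=x$; $\tilde\pi:T\mathbb R^{2n}\times\mathbb R\to\mathbb R^{2n}\times\mathbb R$, $\tilde\pi(x,y,z)=(x,z)$. $\Omega=\sum_i dq_i\wedge d\dot p_i+d\dot q_i\wedge dp_i$ and $\theta=dz+\sum_i(\dot q_i\,dp_i-\dot p_i\,dq_i)$. A critical value of $\pi|_{\mathcal L}$ or $\tilde\pi|_{\tilde{\mathcal L}}$ is the image of a point where the differential of the ($2n$-dimensional source) map is not injective. Center-chord IAS $\phi_{cc}(L)$: with $\alpha(u)=(u,dS(u))$, let $x(u,v)=\frac12(\alpha(u)+\alpha(v))$, $y(u,v)=\frac12(\alpha(u)-\alpha(v))$, and let $f(u,v)$ be the function with $f_u=\omega(x_u,y)$, $f_v=\omega(x_v,y)$, normalized by $f=0$ on the diagonal $u=v$ (which $x$ maps onto $L$). Its singular set is the set of $(u,v)$ where $d^2S(u)-d^2S(v)$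 is a singular matrix. Special IAS $\phi_{sp}(L)$: $S$ real analytic, $H=P+iQ$ its holomorphic extension (so $\overline{H(z)}=H(\bar z)$ and $Q$ is odd in $t$), $z=s+it$, $x(s,t)=(s,\frac{\partial Q}{\partial t})$, $y(s,t)=(t,\frac{\partial Q}{\partial s})$, $f(s,t)=Q-\sum_k t_k\frac{\partial Q}{\partial t_k}$ (so $f=0$ on $t=0$, which $x$ maps onto $L$). Its singular set is the set of $(s,t)$ where $\frac{\partial^2Q}{\partial t^2}$ is a singular matrix. On-shell parts, locally at $0\in L$: $\mathcal E_{cc}^s(L)$ is the image under $x$ of the germ of the singular set of $\phi_{cc}(L)$ at the diagonal parameter point $(0,0)$ (i.e. one uses $\phi_{cc}(L')$ with $L'$ the germ of $L$ at $0$); $\mathcal E_{sp}^s(L)$ is the image under $x$ of the germ of the singular set of $\phi_{sp}(L)$ at $(s,t)=(0,0)$. $\tilde{\mathcal E}_{cc}^s(L)$ and $\tilde{\mathcal E}_{sp}^s(L)$ are the corresponding images under $(x,f)$. Here $0\in L$ means $dS(0)=0$. *)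

(* Defs.v *)
From HB Require Import structures.
From mathcomp Require Import all_boot all_order all_algebra.
From mathcomp Require Import mathcomp_extra boolp classical_sets functions.
From mathcomp Require Import reals topology normedtype sequences derive.
From mathcomp Require Import complex.

Set Implicit Arguments.
Unset Strict Implicit.
Unset Printing Implicit Defensive.

Import Order.TTheory GRing.Theory Num.Theory.
Import numFieldNormedType.Exports.

Local Open Scope classical_set_scope.
Local Open Scope ring_scope.
Local Open Scope complex_scope.

(* [f] is of class C^k on the open set [U].  For a finite-dimensional [V] it is
   equivalent to range over all directions [v] or over those of a basis. *)
Fixpoint Ck_on (R : realType) (V W : normedModType R) (k : nat)
    (U : set V) (f : V -> W) : Prop :=
  if k is k'.+1 then
    (forall x, U x -> differentiable f x) /\
    (forall v : V, Ck_on k' U (fun x => 'D_v f x))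
  else forall x, U x -> {for x, continuous f}.

Definition smooth_on (R : realType) (V W : normedModType R)
    (U : set V) (f : V -> W) : Prop := forall k, Ck_on k U f.

Definition smooth_near (R : realType) (V W : normedModType R)
    (a : V) (f : V -> W) : Prop :=
  exists2 U : set V, open_nbhs a U & smooth_on U f.

Definition monomial (K : numFieldType) (n : nat) (h : 'rV[K]_n)
    (a : 'I_n -> nat) : K := \prod_i h 0 i ^+ a i.

(* [f] is the sum, near [z], of an absolutely convergent power series
   [\sum_a c a * (w - z) ^ a]; the partial sums run over the multi-indices [a]
   all of whose entries are smaller than [N]. *)
Definition analytic_at (K : numFieldType) (n : nat) (f : 'rV[K]_n -> K)
    (z : 'rV[K]_n) : Prop :=
  exists c : ('I_n -> nat) -> K, \forall h \near (0 : 'rV[K]_n),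
    (exists M : K, forall N : nat,
       \sum_(a : {ffun 'I_n -> 'I_N})
          `|c (fun i => a i : nat) * monomial h (fun i => a i : nat)| <= M) /\
    (fun N : nat => \sum_(a : {ffun 'I_n -> 'I_N})
          c (fun i => a i : nat) * monomial h (fun i => a i : nat))
      @ \oo --> f (z + h).

(* Real analytic for [K] the reals, holomorphic for [K] the complex numbers. *)
Definition analytic_near (K : numFieldType) (n : nat) (f : 'rV[K]_n -> K)
    (z : 'rV[K]_n) : Prop := \forall w \near z, analytic_at f w.

Section Submanifolds.
Variables (R : realType) (E B : normedModType R).

(* Velocities at [m] of the curves lying in [M]: this is the tangent space at [m]
   when [M] is an embedded submanifold. *)
Definition tangent (M : set E) (m v : E) : Prop :=
  exists gamma : R -> E,
    [/\ gamma 0 = m, (\forall t \near (0 : R), M (gamma t))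
      & is_derive (0 : R) (1 : R) gamma v].

(* [M] is, near its point [m], an embedded smooth submanifold of dimension [d]:
   [phi] is a local parametrization, [psi] restricts to its inverse. *)
Definition submanifold_near (d : nat) (M : set E) (m : E) : Prop :=
  exists (U : set 'rV[R]_d) (W : set E) (phi : 'rV[R]_d -> E)
         (psi : E -> 'rV[R]_d),
    [/\ open U, open_nbhs m W, M m & phi @` U = M `&` W] /\
    [/\ smooth_on U phi, (forall u, U u -> injective ('d phi u)),
        (forall u, U u -> psi (phi u) = u)
      & {within M `&` W, continuous psi}].

(* The differential at [m] of the restriction of [F] to [M] is the restriction of
   ['d F m] to the tangent space of [M] at [m]. *)
Definition critical_point (F : E -> B) (M : set E) (m : E) : Prop :=
  M m /\ exists v : E, [/\ tangent M m v, v != 0 & 'd F m v = 0].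

Definition critical_values (F : E -> B) (M : set E) : set B :=
  F @` [set m | critical_point F M m].

(* The image under [x] of the germ of [A] at [a] is the set of critical values of
   the germ at [m] of the restriction of [F] to [M].  An image of a germ depends in
   general on the representative (neither [x] nor [F] need be finite-to-one on the
   germ), so the equality is that of the images of suitable arbitrarily small
   representatives. *)
Definition image_germ_is_critical_values (P : topologicalType)
    (x : P -> B) (A : set P) (a : P) (F : E -> B) (M : set E) (m : E) : Prop :=
  forall (W0 : set P) (V0 : set E), nbhs a W0 -> nbhs m V0 ->
  exists (W : set P) (V : set E),
    [/\ open_nbhs a W, W `<=` W0, open_nbhs m V, V `<=` V0
      & x @` (A `&` W) = critical_values F (M `&` V)].

End Submanifolds.

(* [x = (q, p)] *)
Notation phase R n := ('rV[R]_n * 'rV[R]_n)%type.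
(* [(x, y) = ((q, p), (qdot, pdot))] *)
Notation tphase R n := (phase R n * phase R n)%type.

Section Symplectic.
Variables (R : realType) (n : nat).
Implicit Types (a b q p u s t : 'rV[R]_n).

Definition dotp a b : R := \sum_i a 0 i * b 0 i.

Definition omega (v w : phase R n) : R := dotp v.1 w.2 - dotp v.2 w.1.

(* \sum_i dq_i /\ d(pdot_i) + d(qdot_i) /\ dp_i *)
Definition Omega (v w : tphase R n) : R :=
  (dotp v.1.1 w.2.2 - dotp v.2.2 w.1.1) +
  (dotp v.2.1 w.1.2 - dotp v.1.2 w.2.1).

(* dz + \sum_i qdot_i dp_i - pdot_i dq_i, at the point [m] *)
Definition theta (m v : tphase R n * R) : R :=
  v.2 + (dotp m.1.2.1 v.1.1.2 - dotp m.1.2.2 v.1.1.1).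

Definition tpi (m : tphase R n) : phase R n := m.1.
Definition tpi_tilde (m : tphase R n * R) : phase R n * R := (m.1.1, m.2).

Definition Lagrangian_near (M : set (tphase R n)) (m : tphase R n) : Prop :=
  submanifold_near (n + n) M m /\
  \forall m' \near m, forall v w, M m' -> tangent M m' v -> tangent M m' w ->
    Omega v w = 0.

Definition Legendrian_near (M : set (tphase R n * R)) (m : tphase R n * R) :
    Prop :=
  submanifold_near (n + n) M m /\
  \forall m' \near m, forall v, M m' -> tangent M m' v -> theta m' v = 0.

Definition basis_vec (i : 'I_n) : 'rV[R]_n := delta_mx 0 i.

Definition grad (f : 'rV[R]_n -> R) a : 'rV[R]_n :=
  \row_i 'D_(basis_vec i) f a.

Definition hessian (f : 'rV[R]_n -> R) a : 'M[R]_n :=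
  \matrix_(i, j) 'D_(basis_vec i) (fun b => 'D_(basis_vec j) f b) a.

(* [G beta q p].  For the families below, [- dG/dp = beta], so the condition on
   [qdot] forces [beta = qdot] and the germ at [0] of these sets only involves the
   germ of [G] at [0]. *)
Definition genfam_Lagrangian (G : 'rV[R]_n -> 'rV[R]_n -> 'rV[R]_n -> R) :
    set (tphase R n) :=
  [set m | let: ((q, p), (qdot, pdot)) := m in exists beta : 'rV[R]_n,
     [/\ grad (fun b => G b q p) beta = 0,
         grad (fun q' => G beta q' p) q = pdot
       & - grad (fun p' => G beta q p') p = qdot]].

Definition genfam_Legendrian (G : 'rV[R]_n -> 'rV[R]_n -> 'rV[R]_n -> R) :
    set (tphase R n * R) :=
  [set m | let: (((q, p), (qdot, pdot)), z) := m in exists beta : 'rV[R]_n,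
     [/\ grad (fun b => G b q p) beta = 0,
         grad (fun q' => G beta q' p) q = pdot,
         - grad (fun p' => G beta q p') p = qdot
       & z = G beta q p]].

Variable S : 'rV[R]_n -> R.

Definition alpha u : phase R n := (u, grad S u).

Definition cc_x (w : 'rV[R]_n * 'rV[R]_n) : phase R n :=
  2^-1 *: (alpha w.1 + alpha w.2).

Definition cc_y (w : 'rV[R]_n * 'rV[R]_n) : phase R n :=
  2^-1 *: (alpha w.1 - alpha w.2).

Definition cc_height (f : 'rV[R]_n * 'rV[R]_n -> R) : Prop :=
  [/\ smooth_near (0 : 'rV[R]_n * 'rV[R]_n) f,
      (\forall u \near (0 : 'rV[R]_n), f (u, u) = 0)
    & \forall w \near (0 : 'rV[R]_n * 'rV[R]_n), forall i : 'I_n,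
        'D_(basis_vec i, 0) f w =
          omega ('D_(basis_vec i, 0) cc_x w) (cc_y w) /\
        'D_(0, basis_vec i) f w =
          omega ('D_(0, basis_vec i) cc_x w) (cc_y w)].

Definition cc_singular : set ('rV[R]_n * 'rV[R]_n) :=
  [set w | hessian S w.1 - hessian S w.2 \notin unitmx].

Definition G_cc (beta q p : 'rV[R]_n) : R :=
  2^-1 * (S (q + beta) - S (q - beta)) - dotp p beta.

Variable H : 'rV[R[i]]_n -> R[i].

Definition holomorphic_extension : Prop :=
  analytic_near H 0 /\
  \forall a \near (0 : 'rV[R]_n), H (map_mx (real_complex R) a) = (S a)%:C.

Definition sp_Q s t : R :=
  complex.Im (H (\row_j (s 0 j +i* t 0 j))).

Definition sp_x (w : 'rV[R]_n * 'rV[R]_n) : phase R n :=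
  (w.1, grad (sp_Q w.1) w.2).

Definition sp_f (w : 'rV[R]_n * 'rV[R]_n) : R :=
  sp_Q w.1 w.2 - dotp w.2 (grad (sp_Q w.1) w.2).

Definition sp_singular : set ('rV[R]_n * 'rV[R]_n) :=
  [set w | hessian (sp_Q w.1) w.2 \notin unitmx].

Definition G_sp (beta q p : 'rV[R]_n) : R := sp_Q q beta - dotp p beta.

End Symplectic.

(* Main.v *)
Require Import Defs.
From HB Require Import structures.
From mathcomp Require Import all_boot all_order all_algebra.
From mathcomp Require Import mathcomp_extra boolp classical_sets functions.
From mathcomp Require Import prodnormedzmodule.
From mathcomp Require Import reals topology normedtype sequences landau derive.
From mathcomp Require Import complex.
From mathcomp Require Import ring lra.

Import Order.TTheory GRing.Theory Num.Theory.
Import numFieldNormedType.Exports.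

Local Open Scope classical_set_scope.
Local Open Scope ring_scope.
Local Open Scope complex_scope.

Set Implicit Arguments.
Unset Strict Implicit.
Unset Printing Implicit Defensive.

(** Both generating families have the form G(beta, q, p) = F(q, beta) - p.beta,
    where F is smooth near 0: F(q, beta) = (S(q + beta) - S(q - beta)) / 2 in
    the centre-chord case and F(s, t) = Q(s, t) in the special case.  For every
    such family - dG/dp = beta, so the condition on qdot reads beta = qdot, and
    the two remaining equations become p = F_b and pdot = F_q at (q, qdot).
    Hence the set generated by G is, near 0, the graph
    phi(q, b) = ((q, F_b), (b, F_q)) over the (q, qdot)-plane; the Legendrian
    set is the graph of (phi, F - b.F_b).  Everything in the theorem is read off
    this parametrization ([family_critical]).

    - The tangent vectors of a graph are the derivatives of phi
      ([graph_tangentP]).  Omega vanishes on them because the second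
      derivatives of F are symmetric ([derive_swap]), and theta because the
      derivative of the Legendre transform F - b.F_b is F_q.dq - b.dF_b
      ([derive_graph_z]).
    - A tangent vector killed by the projection has q-component 0, and what
      remains is a vector a with a.F_bb = 0 ([family_singularP]).  So the
      critical points are exactly the phi(w) with F_bb(w) singular; in the
      Legendrian case the last coordinate adds no condition, since theta
      vanishes.  As phi is a homeomorphism onto its image, the image of the germ
      of the singular set is the set of critical values of the germ
      ([graph_image_germ]).

    In the special case (q, F_b) and F - b.F_b are literally the maps x and f of
    the IAS.  In the centre-chord case they become so in the linear coordinates
    (q, b) = ((u + v)/2, (u - v)/2), where F_bb is
    (d^2 S(u) - d^2 S(v))/2; near 0 the height f is determined by its
    derivative and its value at 0, and F - b.F_b is such a height
    ([cc_height_unique]).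

    It remains to see that Q = Im H is smooth near 0 and that the graph passes
    through 0.  The power series of H is grouped into a series of polynomials,
    each bounded together with all its derivatives by a polynomial in the norm
    with nonnegative coefficients, such that these majorants have a bounded sum
    inside a ball.  A derivative of a majorant is bounded by the majorant at a
    slightly larger radius, so such series can be differentiated termwise, and
    again any number of times ([majorized_series_smooth]).  Termwise
    Cauchy-Riemann equations give dQ/dt = dS = 0 at 0. *)

(** * Linear maps out of finite-dimensional spaces *)

Section Linear.
Variable R : realType.

Lemma linear_packing (V W : lmodType R) (f : V -> W) :
  linear f -> exists g : {linear V -> W}, f = g :> (V -> W).
Proof.
move=> lf; pose m := GRing.isLinear.Build _ _ _ _ _ lf.
by pose g : {linear V -> W} := HB.pack f m; exists g.
Qed.

(** Automatic continuity is the one consequence of finite dimension that the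
    calculus below relies on; it passes to products, hence to all the nested
    spaces of positions, momenta and velocities. *)
Definition finite_dim (V : normedModType R) : Prop :=
  forall (W : normedModType R) (f : V -> W), linear f -> continuous f.

Lemma finite_dim_rV n : finite_dim 'rV[R]_n.
Proof.
move=> W f /linear_packing[g ->] {f}.
have -> : g = \sum_(i < n) (fun x => x 0 i *: g (delta_mx 0 i)) :> (_ -> _).
  apply/funext => x; rewrite fct_sumE {1}(row_sum_delta x) linear_sum.
  by apply: eq_bigr => i _; rewrite linearZ.
move=> x; elim/big_ind: _ => [|f h cf ch|i _]; first exact: cst_continuous.
- exact: continuousD.
- apply: continuousZr_tmp; exact: coord_continuous.
Qed.

Lemma finite_dim_prod (V1 V2 : normedModType R) :
  finite_dim V1 -> finite_dim V2 -> finite_dim (V1 * V2)%type.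
Proof.
move=> fd1 fd2 W f /linear_packing[g ->] {f}.
have -> : g = (fun x => g (x.1, 0)) + (fun x => g (0, x.2)) :> (_ -> _).
  by apply/funext => -[a b]; rewrite fctE /= -linearD; congr (g (_, _)) => /=;
     rewrite ?addr0 ?add0r.
have c1 : continuous (fun a => g (a, 0)).
  apply: fd1 => k a b; rewrite -linearP; congr (g _).
  by congr (_, _); rewrite /= scaler0 addr0.
have c2 : continuous (fun b => g (0, b)).
  apply: fd2 => k a b; rewrite -linearP; congr (g _).
  by congr (_, _); rewrite /= scaler0 addr0.
move=> x; apply: continuousD.
  by apply: (@continuous_comp _ _ _ fst (fun a => g (a, 0)));
    [exact: cvg_fst|exact: c1].
by apply: (@continuous_comp _ _ _ snd (fun b => g (0, b)));
  [exact: cvg_snd|exact: c2].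
Qed.

Lemma finite_dim_R : finite_dim R.
Proof.
move=> W f /linear_packing[g ->] {f}.
have -> : g = (fun x => x *: g 1) :> (_ -> _).
  by apply/funext => x; rewrite -linearZ /= [_%:A]mulr1.
exact: scalel_continuous.
Qed.

Lemma linear_is_diff (V W : normedModType R) (f : V -> W) x :
  finite_dim V -> linear f -> is_diff x f f.
Proof.
move=> fd lf; have := fd _ _ lf; have [g ->] := linear_packing lf => cg.
by apply: DiffDef; [exact: linear_differentiable|rewrite diff_lin].
Qed.

End Linear.

(** * Calculus of maps of class C^k *)

Section SmoothCalculus.
Variable R : realType.
Implicit Types V W : normedModType R.

Lemma derive_eq_on V W (U : set V) (f g : V -> W) x v :
  open U -> U x -> (forall y, U y -> f y = g y) -> 'D_v f x = 'D_v g x.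
Proof.
move=> oU Ux fg; apply: near_eq_derive.
by have := open_nbhs_nbhs (conj oU Ux); apply: filterS.
Qed.

(** In this epsilon form, differentiability can be transferred between maps
    that agree near a point, and obtained from a limit of estimates. *)
Lemma diff_eps V W (f : V -> W) x e : differentiable f x -> 0 < e ->
  \forall h \near 0, `|f (h + x) - f x - 'd f x h| <= e * `|h|.
Proof.
move=> /diff_locally/eqaddoP df e0; apply: filterS (df _ e0) => h.
by rewrite /= !fctE /= opprD addrA.
Qed.

Lemma is_diff_eps V W (f L : V -> W) x : linear L -> continuous L ->
  (forall e : R, 0 < e ->
     \forall h \near 0, `|f (h + x) - f x - L h| <= e * `|h|) ->
  is_diff x f L.
Proof.
move=> /linear_packing[l ->] cl fl.
have e : f \o shift x = cst (f x) + l +o_ 0 id.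
  apply/eqaddoP => e e0; apply: filterS (fl _ e0) => h.
  by rewrite /= !fctE /= opprD addrA.
have dl := diff_unique cl e.
by apply: DiffDef => //; apply/diff_locallyP; rewrite dl.
Qed.

(** The differentiation rules hold only at points of [U], so the derivative of
    a sum or product agrees with the expected formula on [U] alone; this is what
    lets the inductions on [k] go through. *)
Lemma eq_Ck_on V W (U : set V) k (f g : V -> W) :
  open U -> (forall y, U y -> f y = g y) -> Ck_on k U f -> Ck_on k U g.
Proof.
move=> oU; elim: k f g => [|k IH] f g fg /=.
  move=> cf x Ux; have nfg : \forall y \near x, f y = g y.
    by have := open_nbhs_nbhs (conj oU Ux); apply: filterS.
  have := cf x Ux; rewrite /prop_for /continuous_at (fg x Ux).
  apply: cvg_trans.
  by apply: near_eq_cvg; apply: filterS nfg => y ->.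
move=> [df Df]; split=> [x Ux|v].
  have nfg : \forall y \near x, f y = g y.
    by have := open_nbhs_nbhs (conj oU Ux); apply: filterS.
  have dfx := df x Ux.
  suff [] : is_diff x g ('d f x) by [].
  apply: is_diff_eps => [||e e0]; first exact: linearP.
    exact: diff_continuous.
  have nfg0 : \forall y \near (0 : V), f (y + x) = g (y + x).
    by move: nfg; rewrite (near_shift 0); apply: filterS => y /=; rewrite subr0.
  apply: filterS2 nfg0 (diff_eps dfx e0) => y; rewrite -(fg _ Ux) => ->.
  by [].
apply: IH (Df v) => x Ux; exact: derive_eq_on Ux fg.
Unshelve. all: by end_near. Qed.

Lemma Ck_onS V W (U : set V) k (f : V -> W) : Ck_on k.+1 U f -> Ck_on k U f.
Proof.
elim: k f => [|k IH] f [df Df]; first by move=> x /df/differentiable_continuous.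
by split=> // v; exact: IH.
Qed.

Lemma Ck_on_subset V W (U U' : set V) k (f : V -> W) :
  U' `<=` U -> Ck_on k U f -> Ck_on k U' f.
Proof.
move=> sU; elim: k f => [|k IH] f /=; first by move=> cf x /sU; exact: cf.
by move=> [df Df]; split=> [x /sU|v]; [exact: df|exact: IH].
Qed.

Lemma Ck_on_cst V W (U : set V) k (c : W) : Ck_on k U (cst c : V -> W).
Proof.
elim: k c => [|k IH] c /=; first by move=> x _; exact: cst_continuous.
split=> [x _|v]; first exact: differentiable_cst.
by rewrite (_ : (fun _ => _) = cst 0) //; apply/funext => x; rewrite derive_cst.
Qed.

Lemma Ck_onD V W (U : set V) k (f g : V -> W) :
  open U -> Ck_on k U f -> Ck_on k U g -> Ck_on k U (f + g).
Proof.
move=> oU; elim: k f g => [|k IH] f g /=.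
  by move=> cf cg x Ux; apply: cvgD; [exact: cf|exact: cg].
move=> [df Df] [dg Dg]; split=> [x Ux|v].
  by apply: differentiableD; [exact: df|exact: dg].
apply: eq_Ck_on (IH _ _ (Df v) (Dg v)) => // x Ux.
by rewrite deriveD //; apply: diff_derivable; [exact: df|exact: dg].
Qed.

Lemma Ck_on_sum V W (U : set V) k n (f : 'I_n -> V -> W) :
  open U -> (forall i, Ck_on k U (f i)) -> Ck_on k U (\sum_i f i).
Proof.
move=> oU Cf; elim/big_ind: _ => //; first exact: Ck_on_cst.
by move=> g h; exact: Ck_onD.
Qed.

(** The difference quotients of both sides are the same function. *)
Lemma derive_comp_linear V V' W (A : V' -> V) (f : V -> W) x v :
  linear A -> 'D_v (f \o A) x = 'D_(A v) f (A x).
Proof.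
move=> /linear_packing[g ->]; rewrite /derive.
set q1 := fun h => h^-1 *: _; set q2 := fun h => h^-1 *: _.
suff -> : q1 = q2 by [].
by rewrite funeqE /q1 /q2 => h /=; rewrite linearP.
Qed.

Lemma Ck_on_comp_linear V V' W (A : V' -> V) (U : set V) k (f : V -> W) :
  finite_dim V' -> linear A -> Ck_on k U f -> Ck_on k (A @^-1` U) (f \o A).
Proof.
move=> fd lA; elim: k f => [|k IH] f /=.
  by move=> cf x Ux; apply: continuous_comp; [exact: fd|exact: cf].
move=> [df Df]; split=> [x Ux|v].
  apply: differentiable_comp; last exact: df.
  by have [] := @linear_is_diff _ _ _ A x fd lA.
rewrite (_ : (fun x => _) = (fun x => 'D_(A v) f x) \o A); first exact: IH.
by apply/funext => x; rewrite derive_comp_linear.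
Qed.

Lemma derive_linear_comp V W W' (l : W -> W') (f : V -> W) x v :
  finite_dim W -> linear l -> differentiable f x ->
  'D_v (l \o f) x = l ('D_v f x).
Proof.
move=> fd ll df; have := @linear_is_diff _ _ _ l (f x) fd ll => dl.
rewrite deriveE; last by apply: differentiable_comp => //; apply: ex_diff.
by rewrite diff_comp // /= ?diff_val ?deriveE //; apply: ex_diff.
Qed.

Lemma Ck_on_linear_comp V W W' (l : W -> W') (U : set V) k (f : V -> W) :
  open U -> finite_dim W -> linear l -> Ck_on k U f -> Ck_on k U (l \o f).
Proof.
move=> oU fd ll; elim: k f => [|k IH] f /=.
  by move=> cf x Ux; apply: continuous_comp; [exact: cf|exact: fd].
move=> [df Df]; split=> [x Ux|v].
  apply: differentiable_comp; first exact: df.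
  by have [] := @linear_is_diff _ _ _ l (f x) fd ll.
apply: (eq_Ck_on oU _ (IH _ (Df v))) => x Ux /=.
by rewrite derive_linear_comp //; exact: df.
Qed.

Lemma Ck_onM V (U : set V) k (f g : V -> R) :
  open U -> Ck_on k U f -> Ck_on k U g -> Ck_on k U (f * g).
Proof.
move=> oU; elim: k f g => [|k IH] f g.
  by move=> cf cg x Ux; apply: cvgM; [exact: cf|exact: cg].
move=> Cf Cg; have [df Df] := Cf; have [dg Dg] := Cg; split=> [x Ux|v].
  by apply: differentiableM; [exact: df|exact: dg].
have := Ck_onD oU (IH _ _ (Ck_onS Cf) (Dg v)) (IH _ _ (Ck_onS Cg) (Df v)).
apply: eq_Ck_on => // x Ux.
by rewrite deriveM //; apply: diff_derivable; [exact: df|exact: dg].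
Qed.

Lemma Ck_onZ V W (U : set V) k (c : R) (f : V -> W) : open U ->
  finite_dim W -> Ck_on k U f -> Ck_on k U (fun x => c *: f x).
Proof.
move=> oU fd; apply: Ck_on_linear_comp => //.
by move=> a u v; rewrite scalerDr !scalerA mulrC.
Qed.

Lemma Ck_on_pair V W W' (U : set V) k (f : V -> W) (g : V -> W') :
  open U -> finite_dim W -> finite_dim W' ->
  Ck_on k U f -> Ck_on k U g -> Ck_on k U (fun x => (f x, g x)).
Proof.
move=> oU fd fd' Cf Cg.
have l1 : linear (fun a : W => (a, 0 : W')).
  by move=> c a b; congr (_, _); rewrite /= scaler0 addr0.
have l2 : linear (fun b : W' => (0 : W, b)).
  by move=> c a b; congr (_, _); rewrite /= scaler0 addr0.
have := Ck_onD oU (Ck_on_linear_comp oU fd l1 Cf) (Ck_on_linear_comp oU fd' l2 Cg).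
apply: eq_Ck_on => // x Ux; rewrite fctE /=.
by congr (_, _); rewrite /= ?addr0 ?add0r.
Qed.

(** A row is a sum of images of its entries under linear maps. *)
Lemma Ck_on_row V (U : set V) k n (f : 'I_n -> V -> R) :
  open U -> (forall i, Ck_on k U (f i)) -> Ck_on k U (fun x => \row_i f i x).
Proof.
move=> oU Cf.
have li (i : 'I_n) : linear (fun a : R => a *: (delta_mx 0 i : 'rV[R]_n)).
  by move=> c a b; rewrite scalerDl scalerA.
have := Ck_on_sum oU
  (fun i => Ck_on_linear_comp oU (@finite_dim_R R) (li i) (Cf i)).
apply: eq_Ck_on => // x Ux; rewrite fct_sumE [RHS]row_sum_delta.
by apply: eq_bigr => i _; rewrite mxE.
Qed.

End SmoothCalculus.

(** * Mean values and symmetry of second derivatives *)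

Section MeanValue.
Variable R : realType.
Implicit Types V W : normedModType R.

Lemma derive_dir_linear V W (f : V -> W) x :
  differentiable f x -> linear (fun v => 'D_v f x).
Proof. by move=> df k u v; rewrite !deriveE // linearP. Qed.

Lemma is_derive_line V W (f : V -> W) x v t :
  derivable f (t *: v + x) v ->
  is_derive t 1 (fun s : R => f (s *: v + x)) ('D_v f (t *: v + x)).
Proof.
have e : (fun h : R => h^-1 *: (((fun s : R => f (s *: v + x)) \o shift t)
            (h *: 1) - f (t *: v + x))) =
         (fun h : R => h^-1 *: ((f \o shift (t *: v + x)) (h *: v)
            - f (t *: v + x))).
  by apply/funext => h /=; rewrite [_%:A]mulr1 scalerDl addrA.
by move=> df; apply: DeriveDef; rewrite /derivable /derive e.
Qed.

Lemma MVT_line V (f : V -> R) x v :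
  (forall t : R, 0 <= t <= 1 -> differentiable f (t *: v + x)) ->
  exists2 c, 0 <= c <= 1 & f (v + x) - f x = 'D_v f (c *: v + x).
Proof.
move=> df.
have dl (t : R) : 0 <= t <= 1 ->
    is_derive t 1 (fun s : R => f (s *: v + x)) ('D_v f (t *: v + x)).
  by move=> /df; move/diff_derivable => /(_ v); exact: is_derive_line.
have [||c c01] := @MVT_segment R (fun s : R => f (s *: v + x))
    (fun t => 'D_v f (t *: v + x)) 0 1 ler01.
- by move=> t; rewrite in_itv /= => /andP[t0 t1]; apply: dl; rewrite !ltW.
- apply: derivable_within_continuous => t; rewrite in_itv /= => t01.
  by have [] := dl _ t01.
rewrite scale1r scale0r add0r subr0 mulr1 => e.
by exists c => //; move: c01; rewrite in_itv.
Qed.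

Lemma ball_segment V (x : V) (r t : R) h : 0 <= t <= 1 -> `|h| < r ->
  ball x r (t *: h + x).
Proof.
move=> /andP[t0 t1] hr; rewrite -ball_normE /= opprD addrCA subrr addr0 normrN.
by rewrite normrZ (ger0_norm t0) (le_lt_trans _ hr) // ler_piMl.
Qed.

(** The mean value theorem along [t *: v] turns the second difference into [t]
    times an increment of ['D_v F]; differentiability of ['D_v F] at [x]
    evaluates this increment to first order. *)
Lemma second_difference V (U : set V) (F : V -> R) x v w e :
  open U -> U x -> Ck_on 2 U F -> 0 < e ->
  exists2 d, 0 < d & forall t, 0 < t < d ->
    `|F (t *: v + (t *: w + x)) - F (t *: v + x) - F (t *: w + x) + F x
      - t ^+ 2 * 'D_w (fun y => 'D_v F y) x| <= e * t ^+ 2.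
Proof.
move=> oU Ux [dF /(_ v)[dG _]] e0.
pose G y := 'D_v F y; pose L := 'D_w G x.
pose N := `|v| + `|v| + `|w| + 1.
have N0 : 0 < N by rewrite /N; have := normr_ge0 v; have := normr_ge0 w; lra.
have /nbhs_ballP[d1 /= d10 Hd1] := diff_eps (dG x Ux) (divr_gt0 e0 N0).
have /nbhs_ballP[d2 /= d20 Hd2] := open_nbhs_nbhs (conj oU Ux).
pose d := Num.min d1 d2; have d0 : 0 < d by rewrite lt_min d10.
have [dd1 dd2] : d <= d1 /\ d <= d2 by rewrite !ge_min !lexx orbT.
exists (d / N) => [|t /andP[t0]]; first exact: divr_gt0.
rewrite ltr_pdivlMr // => tN.
have inU (c a : R) : 0 <= c <= 1 -> 0 <= a <= 1 ->
    `|c *: (t *: v) + a *: (t *: w)| < d.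
  move=> /andP[c0 c1] /andP[a0 a1]; apply: le_lt_trans tN.
  rewrite (le_trans (ler_normD _ _)) // !normrZ !ger0_norm //; try exact: ltW.
  have cv : c * (t * `|v|) <= t * `|v| by rewrite ler_piMl // mulr_ge0 // ltW.
  have aw : a * (t * `|w|) <= t * `|w| by rewrite ler_piMl // mulr_ge0 // ltW.
  rewrite /N !mulrDr mulr1; have := mulr_ge0 (ltW t0) (normr_ge0 v).
  by move: cv aw t0; lra.
have UU (c a : R) : 0 <= c <= 1 -> 0 <= a <= 1 ->
    U (c *: (t *: v) + (a *: (t *: w) + x)).
  move=> c01 a01; apply: Hd2; rewrite -ball_normE /= addrA opprD addrCA subrr.
  by rewrite addr0 normrN (lt_le_trans (inU _ _ c01 a01)).
have i01 : (0 <= (1 : R) <= 1)%R by rewrite ler01 lexx.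
have i00 : (0 <= (0 : R) <= 1)%R by rewrite ler01 lexx.
pose tw := t *: w; pose phi y := F (tw + y) - F y.
have dphi (c : R) : 0 <= c <= 1 ->
    is_diff (c *: (t *: v) + x) phi
      (fun h => 'd F (c *: (t *: v) + (tw + x)) h - 'd F (c *: (t *: v) + x) h).
  move=> c01.
  have U1 : U (c *: (t *: v) + (tw + x)) by have := UU _ _ c01 i01; rewrite scale1r.
  have U0 : U (c *: (t *: v) + x).
    by have := UU _ _ c01 i00; rewrite scale0r add0r.
  have D1 : is_diff (c *: (t *: v) + x) (fun y => F (tw + y))
     ('d F (c *: (t *: v) + (tw + x))).
    have D := differentiableP (dF _ U1).
    have Ds : is_diff (c *: (t *: v) + x) (fun y => tw + y) (0 + id).
      exact: is_diffD.
    have e1 : c *: (t *: v) + (tw + x) = tw + (c *: (t *: v) + x).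
      by rewrite addrCA.
    rewrite e1 in D *.
    apply: (is_diff_eq (is_diff_comp Ds D)).
    by apply/funext => y /=; rewrite fctE add0r.
  have D0 := differentiableP (dF _ U0).
  exact: is_diffB.
have [|c c01] := @MVT_line V phi x (t *: v).
  by move=> s /dphi[].
have := dphi c c01 => dph.
rewrite deriveE; last by case: dph.
have lz y : 'd F y (t *: v) = t * 'd F y v by rewrite linearZ.
rewrite diff_val !lz => mv.
have gE y : U y -> 'd F y v = G y by move=> /dF dFy; rewrite /G deriveE.
have U1 : U (c *: (t *: v) + (tw + x)) by have := UU _ _ c01 i01; rewrite scale1r.
have U0 : U (c *: (t *: v) + x).
  by have := UU _ _ c01 i00; rewrite scale0r add0r.
have est h : `|h| < d -> `|G (h + x) - G x - 'd G x h| <= e / N * `|h|.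
  move=> hd; apply: Hd1; rewrite -ball_normE /= sub0r normrN.
  by rewrite (lt_le_trans hd).
have n1 : `|c *: (t *: v) + tw| < d by have := inU c 1 c01 i01; rewrite scale1r.
have n0 : `|c *: (t *: v)| < d.
  by have := inU c 0 c01 i00; rewrite scale0r addr0.
have {}est1 := est _ n1; have {}est0 := est _ n0.
rewrite linearD in est1.
have LE : 'd G x tw = t * L by rewrite /tw linearZ /L deriveE //; exact: dG.
have -> : F (t *: v + (t *: w + x)) - F (t *: v + x) - F (t *: w + x) + F x
   = t * (G (c *: (t *: v) + tw + x) - G (c *: (t *: v) + x)).
  rewrite !gE // -mulrBr addrA in mv; rewrite -mv /phi -/tw (addrCA tw); ring.
have nv1 : `|c *: (t *: v) + tw| <= t * (`|v| + `|w|).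
  rewrite (le_trans (ler_normD _ _)) // !normrZ (ger0_norm (ltW t0)) mulrDr.
  case/andP: c01 => c0 c1; rewrite (ger0_norm c0) lerD2r ler_piMl //.
  by rewrite mulr_ge0 // ltW.
have nv0 : `|c *: (t *: v)| <= t * `|v|.
  rewrite !normrZ (ger0_norm (ltW t0)).
  case/andP: c01 => c0 c1; rewrite (ger0_norm c0) ler_piMl //.
  by rewrite mulr_ge0 // ltW.
rewrite LE in est1; rewrite -/G -/L expr2 -mulrA -mulrBr normrM (gtr0_norm t0).
have -> : G (c *: (t *: v) + tw + x) - G (c *: (t *: v) + x) - t * L =
  (G (c *: (t *: v) + tw + x) - G x - ('d G x (c *: (t *: v)) + t * L)) -
  (G (c *: (t *: v) + x) - G x - 'd G x (c *: (t *: v))) by ring.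
rewrite mulrCA ler_pM2l // (le_trans (ler_normB _ _)) //.
have eN : 0 <= e / N by apply: divr_ge0; exact: ltW.
have := lerD (le_trans est1 (ler_wpM2l eN nv1)) (le_trans est0 (ler_wpM2l eN nv0)).
move=> /le_trans; apply; rewrite -!mulrDr.
set K := _ + _; have KN : K <= N by rewrite /K /N; lra.
rewrite (_ : e / N * (t * K) = e * t * (K / N)); last by ring.
by rewrite ler_piMr ?mulr_ge0 ?(ltW e0) ?(ltW t0) // ler_pdivrMr // mul1r.
Qed.

(** Schwarz: the second difference is symmetric in [v] and [w], and both mixed
    derivatives are the limits of its quotient by [t ^+ 2]. *)
Lemma derive_swap V (U : set V) (F : V -> R) x v w :
  open U -> U x -> Ck_on 2 U F ->
  'D_w (fun y => 'D_v F y) x = 'D_v (fun y => 'D_w F y) x.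
Proof.
move=> oU Ux CF; set A := LHS; set B := RHS.
apply/eqP; rewrite -subr_eq0 -normr_le0; apply/ler_addgt0Pl => e e0.
rewrite addr0.
have e20 : 0 < e / 2 by rewrite divr_gt0.
have [d1 d10 H1] := second_difference v w oU Ux CF e20.
have [d2 d20 H2] := second_difference w v oU Ux CF e20.
pose t := Num.min d1 d2 / 2.
have m0 : 0 < Num.min d1 d2 by rewrite lt_min d10.
have t0 : 0 < t by rewrite divr_gt0.
have tm : t < Num.min d1 d2 by rewrite ltr_pdivrMr // ltr_pMr // ltr1n.
have := H1 t; rewrite t0 (lt_le_trans tm) ?ge_min ?lexx // => /(_ isT).
have := H2 t; rewrite t0 (lt_le_trans tm) ?ge_min ?lexx ?orbT // => /(_ isT).
rewrite (addrCA (t *: w)) -/A -/B => h2 h1.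
have t20 : 0 < t ^+ 2 by rewrite exprn_gt0.
rewrite -(ler_pM2l t20) -[X in X * _](gtr0_norm t20) -normrM.
have := le_trans (ler_normB _ _) (lerD h2 h1).
rewrite -mulrDl -splitr [e * _]mulrC => /(le_trans _); apply.
rewrite le_eqVlt; apply/orP; left; apply/eqP; congr (`| _ |); ring.
Qed.

End MeanValue.

(** * Submanifolds that are graphs over phase space *)

Section GraphOverPhase.
Variables (R : realType) (n : nat) (E : normedModType R).
Variables (M : set E) (U : set (phase R n)).
Variables (phi : phase R n -> E) (psi : E -> phase R n).
Hypotheses (fdE : finite_dim E) (oU : open U) (lin_psi : linear psi).
Hypotheses (Cphi : smooth_on U phi) (phiK : forall w, U w -> psi (phi w) = w).
Hypothesis graphM : forall m, U (psi m) -> M m <-> m = phi (psi m).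

Lemma finite_dim_phase : finite_dim (phase R n).
Proof. by apply: finite_dim_prod; exact: finite_dim_rV. Qed.

Let dphi w : U w -> differentiable phi w.
Proof. by move=> Uw; have [/(_ w Uw)] := Cphi 1. Qed.

(** Differentiate [psi \o phi = id]. *)
Lemma graph_coord_derive w h : U w -> psi ('D_h phi w) = h.
Proof.
move=> Uw; rewrite -derive_linear_comp //; last exact: dphi.
by rewrite (derive_eq_on (g := id) h oU Uw) ?derive_id.
Qed.

Lemma graph_mem w : U w -> M (phi w).
Proof. by move=> Uw; apply/graphM; rewrite phiK. Qed.

(** A curve [gamma] in a graph is [phi \o (psi \o gamma)], so its velocity is
    given by the chain rule; conversely [phi] maps lines to curves in [M]. *)
Lemma graph_tangentP w v :
  U w -> tangent M (phi w) v <-> exists h, v = 'D_h phi w.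
Proof.
move=> Uw; split=> [[gamma [g0 Mg dg]]|[h ->]].
  have dg0 : differentiable gamma 0 by apply/derivable1_diffP; case: dg.
  have dpsi := @linear_is_diff _ _ _ psi (gamma 0) fdE lin_psi.
  have nU : \forall t \near (0 : R), U (psi (gamma t)).
    have cpg : {for (0 : R), continuous (psi \o gamma)}.
      apply: continuous_comp; first exact: differentiable_continuous.
      exact: fdE.
    by apply: cpg; apply: open_nbhs_nbhs; split=> //=; rewrite g0 phiK.
  exists (psi v); case: dg => _ <-.
  have gE : 'D_1 gamma 0 = 'D_1 (phi \o (psi \o gamma)) 0.
    apply: near_eq_derive; apply: filterS2 Mg nU => t Mt Ut /=.
    by apply/graphM.
  have e0 : psi (gamma 0) = w by rewrite g0 phiK.
  have D1 : is_diff (0 : R) (psi \o gamma) (psi \o 'd gamma 0).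
    exact: is_diff_comp (differentiableP dg0) dpsi.
  have dph : differentiable phi ((psi \o gamma) 0) by rewrite /= e0; exact: dphi.
  have D2 := is_diff_comp D1 (differentiableP dph).
  rewrite [LHS]gE deriveE; last by case: D2.
  rewrite (@diff_val _ _ _ _ _ _ _ D2) /= e0 -(deriveE _ (dphi Uw)).
  by rewrite (deriveE _ dg0).
exists (fun t => phi (t *: h + w)); split.
- by rewrite scale0r add0r.
- have cl : {for (0 : R), continuous (fun t : R => t *: h + w)}.
    apply: (@continuousD _ _ _ (fun t : R => t *: h) (fun _ => w)).
      exact: scalel_continuous.
    exact: cst_continuous.
  have nUw : nbhs (0 *: h + w) U.
    by rewrite scale0r add0r; exact: open_nbhs_nbhs.
  have nt : \forall t \near (0 : R), U (t *: h + w) by exact: cl nUw.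
  near=> t; apply: graph_mem; near: t; exact: nt.
- have dl : derivable phi ((0 : R) *: h + w) h.
    by rewrite scale0r add0r; exact: diff_derivable (dphi Uw).
  by have := is_derive_line dl; rewrite scale0r add0r.
Unshelve. all: by end_near. Qed.

Lemma linear_split_row : linear (fun u : 'rV[R]_(n + n) => (lsubmx u, rsubmx u)).
Proof. by move=> k u v; rewrite !linearP. Qed.

(** The parametrization has to start from a space of rows, so [phi] is
    precomposed with the splitting of a row into two halves. *)
Lemma graph_submanifold w : U w -> submanifold_near (n + n) M (phi w).
Proof.
move=> Uw; pose split (u : 'rV[R]_(n + n)) := (lsubmx u, rsubmx u).
have ls : linear split := linear_split_row.
have fds := @finite_dim_rV R (n + n).
pose join (p : phase R n) : 'rV[R]_(n + n) := row_mx p.1 p.2.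
have lj : linear join.
  by move=> k u v; rewrite /join scale_row_mx add_row_mx.
have sK p : split (join p) = p
  by rewrite /split /join row_mxKl row_mxKr -surjective_pairing.
have jK u : join (split u) = u by rewrite /join hsubmxK.
exists (split @^-1` U), (psi @^-1` U), (phi \o split), (join \o psi).
split; split.
- by apply: open_comp => // x _; exact: fds.
- split; first by apply: open_comp => // x _; exact: fdE.
  by rewrite /= phiK.
- exact: graph_mem.
- rewrite eqEsubset; split=> [_ [u Uu <-]|m [Mm Um]] /=.
    by split; [exact: graph_mem|rewrite phiK].
  exists (join (psi m)); rewrite /= sK //; apply/esym.
  exact/graphM.
- by move=> k; apply: Ck_on_comp_linear.
- move=> u Uu h1 h2.
  have dps : differentiable (phi \o split) u.
    apply: differentiable_comp (dphi Uu).
    by have [] := @linear_is_diff _ _ _ split u fds ls.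
  have dE h : psi ('d (phi \o split) u h) = split h.
    rewrite -(deriveE h dps) derive_comp_linear; last exact: ls.
    exact: graph_coord_derive.
  by move=> /(congr1 psi); rewrite !dE => /(congr1 join); rewrite !jK.
- by move=> u Uu /=; rewrite phiK.
- apply: continuous_subspaceT => x; apply: continuous_comp; first exact: fdE.
  exact: finite_dim_phase.
Qed.

(** With [W = W1 `&` phi @^-1` V1] and [V = V1 `&` psi @^-1` W1] the maps [phi]
    and [psi] are inverse bijections between [W] and [M `&` V], and they exchange
    the points of [A] with the critical points of [F]. *)
Lemma graph_image_germ (B : normedModType R) (F : E -> B) (x : phase R n -> B)
    (A : set (phase R n)) : linear F -> U 0 ->
  (forall w, U w -> x w = F (phi w)) ->
  (forall w, U w -> A w <-> exists2 h : phase R n, h != 0 & F ('D_h phi w) = 0) ->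
  image_germ_is_critical_values x A 0 F M (phi 0).
Proof.
move=> lF U0 xE AE W0 V0 nW0 nV0.
have [W1 [oW1 W10] sW1] : exists2 W1 : set (phase R n),
    open_nbhs (0 : phase R n) W1 & W1 `<=` W0 `&` U.
  have : nbhs (0 : phase R n) (W0 `&` U).
    by apply: filterI => //; apply: open_nbhs_nbhs.
  by rewrite nbhsE => -[W1 oW1 s1]; exists W1.
have [V1 [oV1 V10] sV1] : exists2 V1, open_nbhs (phi 0) V1 & V1 `<=` V0.
  by move: nV0; rewrite nbhsE => -[V1 oV1 s1]; exists V1.
pose V := V1 `&` (psi @^-1` W1).
have oV : open V by apply: openI => //; apply: open_comp => // z _; exact: fdE.
have sWU (w : phase R n) : W1 w -> U w by move=> /sW1[].
pose W := W1 `&` (phi @^-1` V1).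
have oW : open W.
  rewrite openE => w [W1w V1w]; rewrite /interior /W; apply: filterI.
    exact: open_nbhs_nbhs.
  have : {for w, continuous phi}.
    by apply: differentiable_continuous; apply: dphi; exact: sWU.
  by apply; exact: open_nbhs_nbhs.
(* Being tangent is a local condition, so cutting [M] down to the open
   set [V] keeps the tangent vectors. *)
have tV w v : W w -> tangent (M `&` V) (phi w) v <-> tangent M (phi w) v.
  move=> [W1w V1w]; split=> -[g [g0 Mg dg]]; exists g; split => //.
    by apply: filterS Mg => t [].
  have cg : {for (0 : R), continuous g}.
    apply: differentiable_continuous; apply/derivable1_diffP; by case: dg.
  have nV : \forall t \near (0 : R), V (g t).
    apply: cg; apply: open_nbhs_nbhs; split=> //=; rewrite g0.
    by split=> //=; rewrite phiK //; exact: sWU.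
  by apply: filterS2 Mg nV => t.
have phiV w : W w -> (M `&` V) (phi w).
  move=> [W1w V1w]; have Uw := sWU _ W1w.
  by split; [exact: graph_mem|split=> //=; rewrite phiK].
exists W, V; split.
- by split.
- by move=> w [/sW1[]].
- by split=> //; split=> //=; rewrite phiK.
- by move=> m [/sV1].
rewrite /critical_values eqEsubset; split=> b.
  move=> [w [Aw Ww] <-]; have Uw := sWU _ Ww.1; exists (phi w); last by rewrite xE.
  split; first exact: phiV.
  have [h h0 Fh] := (AE w Uw).1 Aw.
  exists ('D_h phi w); split.
  - by apply/tV => //; apply/graph_tangentP => //; exists h.
  - apply: contra_neq h0 => e; rewrite -(graph_coord_derive h Uw) e.
    by have [l ->] := linear_packing lin_psi; rewrite linear0.
  - have dF := @linear_is_diff _ _ _ F (phi w) fdE lF.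
    by rewrite (@diff_val _ _ _ _ _ _ _ dF).
move=> [m [[Mm [V1m W1m]] [v [tv v0 Fv]]] <-].
have Uw := sWU _ W1m; have mE : m = phi (psi m) by apply/graphM.
set w := psi m in W1m Uw mE.
have Ww : W w by split=> //=; rewrite -mE.
exists w; last by rewrite xE // -mE.
split=> //; apply/AE => //.
rewrite mE in tv; move/tV: tv => /(_ Ww)/(graph_tangentP _ Uw)[h vE].
exists h.
  apply: contra_neq v0 => h0; rewrite vE h0 deriveE; last exact: dphi.
  exact: linear0.
have dF := @linear_is_diff _ _ _ F m fdE lF.
by rewrite -vE -Fv (@diff_val _ _ _ _ _ _ _ dF).
Qed.

End GraphOverPhase.

Section Reparametrization.
Variables (R : realType) (E B : normedModType R) (P P' : topologicalType).

(** The images of germs depend only on the germs of the map and of the set, and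
    a homeomorphism of the parameters carries neighbourhoods to
    neighbourhoods. *)
Lemma image_germ_reparam (x : P -> B) (x' : P' -> B) (A : set P) (A' : set P')
    (a : P) (a' : P') (T : P' -> P) (T' : P -> P') (F : E -> B) (M : set E) (m : E) :
  continuous T -> continuous T' -> cancel T T' -> cancel T' T -> T a' = a ->
  (\forall w \near a', x' w = x (T w) /\ (A' w <-> A (T w))) ->
  image_germ_is_critical_values x A a F M m ->
  image_germ_is_critical_values x' A' a' F M m.
Proof.
move=> cT cT' TK T'K Ta nE H W0 V0 nW0 nV0.
have nW : nbhs a (T' @^-1` (W0 `&`
    [set w | x' w = x (T w) /\ (A' w <-> A (T w))])).
  by rewrite -Ta; apply: cT'; rewrite TK; exact: filterI.
have [W [V [[oW Wa] sW oV sV e]]] := H _ _ nW nV0.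
have sW' w : W (T w) -> W0 w /\ (x' w = x (T w) /\ (A' w <-> A (T w))).
  by move=> /sW; rewrite /= TK.
exists (T @^-1` W), V; split=> //.
- by split; [exact: open_comp|rewrite /= Ta].
- by move=> w /sW'[].
rewrite -e eqEsubset; split=> b [w [Aw Ww] <-].
  by have [_ [-> AE]] := sW' _ Ww; exists (T w) => //; split=> //; apply/AE.
have Ww' : W (T (T' w)) by rewrite T'K.
have [_ [xE AE]] := sW' _ Ww'.
exists (T' w); last by rewrite xE T'K.
by split=> //; apply/AE; rewrite T'K.
Qed.

End Reparametrization.

(** * Derivatives of pairs, rows and functions on phase space *)

Section MoreCalculus.
Variable R : realType.
Implicit Types V W : normedModType R.

Lemma derive_linear V W (l : V -> W) x v :
  finite_dim V -> linear l -> 'D_v l x = l v.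
Proof.
move=> fd ll; have dl := @linear_is_diff _ _ _ l x fd ll.
by rewrite deriveE ?diff_val //; case: dl.
Qed.

Lemma Ck_on_linear V W (U : set V) k (l : V -> W) :
  finite_dim V -> linear l -> Ck_on k U l.
Proof.
move=> fd ll; case: k => [|k]; first by move=> x _; exact: fd.
split=> [x _|v]; first by have [] := @linear_is_diff _ _ _ l x fd ll.
rewrite (_ : (fun _ => _) = cst (l v)); first exact: Ck_on_cst.
by apply/funext => x; rewrite derive_linear.
Qed.

Lemma derive_pair V W W' (f : V -> W) (g : V -> W') x v :
  differentiable f x -> differentiable g x ->
  'D_v (fun y => (f y, g y)) x = ('D_v f x, 'D_v g x).
Proof.
move=> df dg; have D := is_diff_pair (differentiableP df) (differentiableP dg).
rewrite (deriveE v (@ex_diff _ _ _ _ _ _ _ D)) (@diff_val _ _ _ _ _ _ _ D).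
by rewrite (deriveE v df) (deriveE v dg).
Qed.

Lemma derive_row V n (f : V -> 'rV[R]_n) x v i :
  differentiable f x -> ('D_v f x) 0 i = 'D_v (fun y => f y 0 i) x.
Proof. by move=> df; rewrite derive_mx ?mxE //; exact: diff_derivable. Qed.

(** Both sides have the same difference quotients. *)
Lemma partial_snd V V' W (F : V * V' -> W) q b v :
  'D_v (fun b' => F (q, b')) b = 'D_(0, v) F (q, b) /\
  (derivable F (q, b) (0, v) -> derivable (fun b' => F (q, b')) b v).
Proof.
have e : (fun h : R => h^-1 *: (((fun b' => F (q, b')) \o shift b) (h *: v)
      - F (q, b))) =
    (fun h : R => h^-1 *: ((F \o shift (q, b)) (h *: (0, v)) - F (q, b))).
  apply/funext => h /=; congr (_ *: (F _ - _)).
  by congr (_, _); rewrite /= scaler0 add0r.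
by rewrite /derive /derivable e.
Qed.

Lemma partial_fst V V' W (F : V * V' -> W) q b v :
  'D_v (fun q' => F (q', b)) q = 'D_(v, 0) F (q, b) /\
  (derivable F (q, b) (v, 0) -> derivable (fun q' => F (q', b)) q v).
Proof.
have e : (fun h : R => h^-1 *: (((fun q' => F (q', b)) \o shift q) (h *: v)
      - F (q, b))) =
    (fun h : R => h^-1 *: ((F \o shift (q, b)) (h *: (v, 0)) - F (q, b))).
  apply/funext => h /=; congr (_ *: (F _ - _)).
  by congr (_, _); rewrite /= scaler0 add0r.
by rewrite /derive /derivable e.
Qed.

End MoreCalculus.

Section DotProduct.
Variables (R : realType) (n : nat).
Implicit Types a b c : 'rV[R]_n.

Lemma dotpC a b : dotp a b = dotp b a.
Proof. by apply: eq_bigr => i _; rewrite mulrC. Qed.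

Lemma dotp_linear a : linear (dotp a).
Proof.
move=> k u v; rewrite /dotp scaler_sumr -big_split; apply: eq_bigr => i _ /=.
by rewrite !mxE mulrDr mulrCA.
Qed.

Lemma dotp0 a : dotp a 0 = 0.
Proof. by rewrite /dotp big1 // => i _; rewrite mxE mulr0. Qed.

Lemma dotp_basis a i : dotp a (basis_vec R i) = a 0 i.
Proof.
rewrite /dotp (bigD1 i) //= big1 ?addr0 => [|j ji].
  by rewrite mxE !eqxx mulr1.
by rewrite mxE eqxx (negbTE ji) mulr0.
Qed.

(** For two tangent vectors of the graph of [(F_b, F_q)] the hypothesis is the
    symmetry of the second derivative of [F]. *)
Lemma Omega_symmetric (h k : phase R n) hb hq kb kq :
  dotp h.1 kq + dotp h.2 kb = dotp k.1 hq + dotp k.2 hb ->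
  Omega ((h.1, hb), (h.2, hq)) ((k.1, kb), (k.2, kq)) = 0.
Proof.
by move=> e; rewrite /Omega /= (dotpC hq) (dotpC hb) addrACA -opprD e subrr.
Qed.

Lemma phase_sum (w : phase R n) :
  w = \sum_i w.1 0 i *: ((basis_vec R i, 0) : phase R n)
    + \sum_i w.2 0 i *: ((0, basis_vec R i) : phase R n).
Proof.
have l1 : linear (fun a : 'rV[R]_n => (a, 0) : phase R n).
  by move=> k a b; congr (_, _); rewrite /= scaler0 addr0.
have l2 : linear (fun a : 'rV[R]_n => (0, a) : phase R n).
  by move=> k a b; congr (_, _); rewrite /= scaler0 addr0.
have e (f : 'rV[R]_n -> phase R n) a : linear f ->
    f a = \sum_i a 0 i *: f (basis_vec R i).
  move=> /linear_packing[g ->]; rewrite {1}(row_sum_delta a) linear_sum.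
  by apply: eq_bigr => i _; rewrite linearZ.
rewrite -(e _ _ l1) -(e _ _ l2) {1}(surjective_pairing w).
by congr (_, _); rewrite /= ?addr0 ?add0r.
Qed.

Lemma derive_phase (W : normedModType R) (f : phase R n -> W) w h :
  differentiable f w ->
  'D_h f w = \sum_i h.1 0 i *: 'D_(basis_vec R i, 0) f w
           + \sum_i h.2 0 i *: 'D_(0, basis_vec R i) f w.
Proof.
move=> df; have ld := derive_dir_linear df.
have [g gE] := linear_packing ld; have {}gE v : 'D_v f w = g v by rewrite -gE.
rewrite gE {1}(phase_sum h) linearD !linear_sum; congr (_ + _);
  by apply: eq_bigr => i _; rewrite linearZ gE.
Qed.

Lemma derive_phase_snd (W : normedModType R) (f : phase R n -> W) w a :
  differentiable f w ->
  'D_(0, a) f w = \sum_i a 0 i *: 'D_(0, basis_vec R i) f w.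
Proof.
move=> df; rewrite (derive_phase _ df) [X in X + _]big1 ?add0r // => i _.
by rewrite [X in X *: _]mxE scale0r.
Qed.

Lemma det_singularP (A : 'M[R]_n) :
  A \notin unitmx <-> exists2 h : 'rV_n, h != 0 & h *m A = 0.
Proof. by rewrite unitmxE unitfE negbK; split=> /det0P. Qed.

End DotProduct.

(** * Families whose generating function is affine in the momentum *)

Section GeneratingFunction.
Variables (R : realType) (n : nat) (F : phase R n -> R) (U : set (phase R n)).
Hypotheses (oU : open U) (U0 : U 0) (CF : smooth_on U F).

Notation e_ i := (basis_vec R (i : 'I_n)).

Definition grad_q (w : phase R n) := \row_(i < n) 'D_(e_ i, 0) F w.
Definition grad_b (w : phase R n) := \row_(i < n) 'D_(0, e_ i) F w.
Definition family (b q p : 'rV[R]_n) := F (q, b) - dotp p b.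
Definition graph (w : phase R n) : tphase R n :=
  ((w.1, grad_b w), (w.2, grad_q w)).
(** The value of the family at its critical point: minus the Legendre transform
    of [F] in its second variable. *)
Definition graph_z (w : phase R n) : R := F w - dotp w.2 (grad_b w).
Definition graph_tilde (w : phase R n) := (graph w, graph_z w).
Definition coord (m : tphase R n) : phase R n := (m.1.1, m.2.1).
Definition coord_tilde (m : tphase R n * R) : phase R n := coord m.1.

Let fdP : finite_dim (phase R n) := @finite_dim_phase R n.

Let dF w : U w -> differentiable F w.
Proof. by move=> Uw; have [/(_ w Uw)] := CF 1. Qed.

Lemma grad_bE q b : grad (fun b' => F (q, b')) b = grad_b (q, b).
Proof. by apply/rowP => i; rewrite !mxE (partial_snd F q b _).1. Qed.

Lemma hessianE q b i j : hessian (fun b' => F (q, b')) b i j =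
  'D_(0, e_ i) (fun y => 'D_(0, e_ j) F y) (q, b).
Proof.
rewrite [LHS]mxE.
have -> : (fun b' => 'D_(e_ j) (fun b'' => F (q, b'')) b') =
    (fun b' => 'D_(0, e_ j) F (q, b')).
  by apply/funext => b'; exact: (partial_snd F q b' _).1.
exact: (partial_snd (fun y => 'D_(0, e_ j) F y) q b (e_ i)).1.
Qed.

(** Since [- dG/dp = beta], the condition on [qdot] forces [beta = qdot]; then
    [dG/dbeta = 0] determines [p] and [dG/dq] determines [pdot]. *)
Lemma family_critical m : U (coord m) -> forall z,
  (exists beta, [/\ grad (fun b => family b m.1.1 m.1.2) beta = 0,
      grad (fun q => family beta q m.1.2) m.1.1 = m.2.2,
      - grad (fun p => family beta m.1.1 p) m.1.2 = m.2.1
    & z = family beta m.1.1 m.1.2]) <->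
  m = graph (coord m) /\ z = graph_z (coord m).
Proof.
case: m => [[q p] [b pd]]; rewrite /coord /= => Uqb z.
have fdr := @finite_dim_rV R n.
have gp c : - grad (fun p' => family c q p') p = c.
  apply/rowP => i; rewrite !mxE /family.
  rewrite (_ : (fun _ => _) = cst (F (q, c)) + (- dotp c)).
    rewrite deriveD ?derive_cst ?add0r.
    - rewrite deriveN ?opprK.
        by rewrite (derive_linear _ _ fdr (@dotp_linear _ _ c)) dotp_basis.
      apply: diff_derivable.
      by have [] := @linear_is_diff _ _ _ (dotp c) p fdr (@dotp_linear _ _ c).
    - exact: derivable_cst.
    - apply: derivableN; apply: diff_derivable.
      by have [] := @linear_is_diff _ _ _ (dotp c) p fdr (@dotp_linear _ _ c).
  by apply/funext => p'; rewrite fctE dotpC.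
have gb : grad (fun b' => family b' q p) b = grad_b (q, b) - p.
  apply/rowP => i; rewrite !mxE /family.
  rewrite (_ : (fun _ => _) = (fun b' => F (q, b')) + (- dotp p)) //.
  have dp : derivable (dotp p) b (e_ i).
    apply: diff_derivable.
    by have [] := @linear_is_diff _ _ _ (dotp p) b fdr (@dotp_linear _ _ p).
  rewrite deriveD; last exact: derivableN.
    rewrite deriveN // (derive_linear _ _ fdr (@dotp_linear _ _ p)) dotp_basis.
    by rewrite (partial_snd F q b _).1.
  by apply: (partial_snd F q b _).2; apply: diff_derivable; exact: dF.
have gq : grad (fun q' => family b q' p) q = grad_q (q, b).
  apply/rowP => i; rewrite !mxE /family.
  rewrite (_ : (fun _ => _) = (fun q' => F (q', b)) + cst (- dotp p b)) //.
  rewrite deriveD ?derive_cst ?addr0; last exact: derivable_cst.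
    by rewrite (partial_fst F q b _).1.
  by apply: (partial_fst F q b _).2; apply: diff_derivable; exact: dF.
split.
  move=> [c [+ + + zE]]; rewrite gp => + + cb; rewrite {}cb in zE *.
  rewrite gb gq => /eqP; rewrite subr_eq0 => /eqP gE <-.
  by rewrite /graph /graph_z /= gE zE /family (dotpC b).
rewrite /graph /graph_z /= => -[[pE pdE] zE]; exists b; rewrite gp gb gq.
by rewrite -pE -pdE subrr zE /family -pE (dotpC b).
Qed.

Lemma family_Lagrangian_graph m :
  U (coord m) -> genfam_Lagrangian family m <-> m = graph (coord m).
Proof.
move=> Um; have H := family_critical Um; split.
  case: m Um H => [[q p] [b pd]] Um H [c [h1 h2 h3]].
  by have [] := (H _).1 (ex_intro _ c (And4 h1 h2 h3 erefl)).
move=> mE; have [c [h1 h2 h3 h4]] := (H _).2 (conj mE erefl).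
by case: m h1 h2 h3 {Um H h4 mE} => [[q p] [b pd]] h1 h2 h3; exists c.
Qed.

Lemma family_Legendrian_graph m : U (coord_tilde m) ->
  genfam_Legendrian family m <-> m = graph_tilde (coord_tilde m).
Proof.
case: m => m z Um; have H := @family_critical m Um z.
rewrite /graph_tilde /coord_tilde /=.
have G : genfam_Legendrian family (m, z) <->
  (exists beta, [/\ grad (fun b => family b m.1.1 m.1.2) beta = 0,
      grad (fun q => family beta q m.1.2) m.1.1 = m.2.2,
      - grad (fun p => family beta m.1.1 p) m.1.2 = m.2.1
    & z = family beta m.1.1 m.1.2]) by case: m {Um H} => [[q p] [b pd]].
apply: iff_trans G (iff_trans H _).
split=> [[mE zE]|E]; first by rewrite -mE -zE.
by split; [exact: (congr1 fst E)|exact: (congr1 snd E)].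
Qed.

Lemma smooth_grad_b : smooth_on U grad_b.
Proof. by move=> k; apply: Ck_on_row => // i; have [_ +] := CF k.+1; apply. Qed.

Lemma smooth_grad_q : smooth_on U grad_q.
Proof. by move=> k; apply: Ck_on_row => // i; have [_ +] := CF k.+1; apply. Qed.

Let lfst : linear (fst : phase R n -> 'rV[R]_n). Proof. by move=> k u v. Qed.
Let lsnd : linear (snd : phase R n -> 'rV[R]_n). Proof. by move=> k u v. Qed.

Lemma smooth_graph : smooth_on U graph.
Proof.
have fdr := @finite_dim_rV R n.
by move=> k; do ![apply: Ck_on_pair => //; try exact: finite_dim_phase];
  try exact: Ck_on_linear; [exact: smooth_grad_b|exact: smooth_grad_q].
Qed.

Lemma dotp_smooth k (f g : phase R n -> 'rV[R]_n) :
  Ck_on k U f -> Ck_on k U g -> Ck_on k U (fun w => dotp (f w) (g w)).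
Proof.
move=> Cf Cg.
have lc (i : 'I_n) : linear (fun a : 'rV[R]_n => a 0 i).
  by move=> c a b; rewrite !mxE.
pose co (h : phase R n -> 'rV[R]_n) i : phase R n -> R := fun w => h w 0 i.
have Cco h i : Ck_on k U h -> Ck_on k U (co h i).
  exact: (@Ck_on_linear_comp _ _ _ _ (fun a : 'rV[R]_n => a 0 i)) oU
    (@finite_dim_rV R n) (lc i).
have C i : Ck_on k U (co f i * co g i) by apply: Ck_onM => //; exact: Cco.
by have := Ck_on_sum oU C; apply: eq_Ck_on => // w Uw; rewrite fct_sumE.
Qed.

Lemma derive_dotp (f g : phase R n -> 'rV[R]_n) w h :
  differentiable f w -> differentiable g w ->
  'D_h (fun y => dotp (f y) (g y)) w =
    dotp ('D_h f w) (g w) + dotp (f w) ('D_h g w).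
Proof.
move=> df dg.
have dfi i : derivable (fun y => f y 0 i) w h.
  exact: (derivable_mxP f w h).1 (diff_derivable df) 0 i.
have dgi i : derivable (fun y => g y 0 i) w h.
  exact: (derivable_mxP g w h).1 (diff_derivable dg) 0 i.
rewrite (_ : (fun y => _) =
  \sum_i (((fun y => f y 0 i) : phase R n -> R) * (fun y => g y 0 i))); last first.
  by apply/funext => y; rewrite fct_sumE.
rewrite derive_sum => [|i]; last exact: derivableM.
rewrite /dotp -big_split; apply: eq_bigr => i _ /=.
rewrite deriveM // (derive_row _ _ df) (derive_row _ _ dg) addrC.
by congr (_ + _); exact: mulrC.
Qed.

Lemma smooth_graph_z : smooth_on U graph_z.
Proof.
move=> k; have -> : graph_z = F + (fun w => -1 *: dotp w.2 (grad_b w)).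
  by apply/funext => w; rewrite fctE scaleN1r.
apply: Ck_onD => //; apply: Ck_onZ => //; first exact: finite_dim_R.
by apply: dotp_smooth; [exact: Ck_on_linear|exact: smooth_grad_b].
Qed.

Lemma smooth_graph_tilde : smooth_on U graph_tilde.
Proof.
move=> k; apply: Ck_on_pair => //.
- by apply: finite_dim_prod; exact: finite_dim_phase.
- exact: finite_dim_R.
- exact: smooth_graph.
- exact: smooth_graph_z.
Qed.

Let dgb w : U w -> differentiable grad_b w.
Proof. by move=> Uw; have [/(_ w Uw)] := smooth_grad_b 1. Qed.
Let dgq w : U w -> differentiable grad_q w.
Proof. by move=> Uw; have [/(_ w Uw)] := smooth_grad_q 1. Qed.
Let dlin (W : normedModType R) (l : phase R n -> W) w :
  linear l -> differentiable l w.
Proof. by move=> ll; have [] := @linear_is_diff _ _ _ l w fdP ll. Qed.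

Lemma derive_graph w h : U w ->
  'D_h graph w = ((h.1, 'D_h grad_b w), (h.2, 'D_h grad_q w)).
Proof.
move=> Uw; rewrite derive_pair.
- have e1 := derive_pair h (dlin w lfst) (dgb Uw).
  have e2 := derive_pair h (dlin w lsnd) (dgq Uw).
  rewrite (derive_linear _ _ fdP lfst) in e1.
  rewrite (derive_linear _ _ fdP lsnd) in e2.
  by congr (_, _); [exact: e1|exact: e2].
- by apply: differentiable_pair; [exact: dlin|exact: dgb].
- by apply: differentiable_pair; [exact: dlin|exact: dgq].
Qed.

Lemma derive_F w h : U w ->
  'D_h F w = dotp h.1 (grad_q w) + dotp h.2 (grad_b w).
Proof.
move=> Uw; rewrite derive_phase; last exact: dF.
by congr (_ + _); apply: eq_bigr => i _; rewrite mxE.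
Qed.

(** The terms in [h.2] cancel, as always for a Legendre transform; the formula
    says that [theta] vanishes on the velocities of [graph_tilde]. *)
Lemma derive_graph_z w h : U w ->
  'D_h graph_z w = dotp h.1 (grad_q w) - dotp w.2 ('D_h grad_b w).
Proof.
move=> Uw; have dz : differentiable (fun y => dotp y.2 (grad_b y)) w.
  have C : Ck_on 1 U (fun y => dotp y.2 (grad_b y)).
    by apply: dotp_smooth; [exact: Ck_on_linear|exact: smooth_grad_b].
  by have [/(_ w Uw)] := C.
rewrite (_ : graph_z = F - (fun y => dotp y.2 (grad_b y))) //.
rewrite deriveB; [|exact: diff_derivable (dF Uw)|exact: diff_derivable].
rewrite derive_F // derive_dotp; [|exact: dlin|exact: dgb].
by rewrite (derive_linear _ _ fdP lsnd) opprD addrA addrK.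
Qed.

(** The second derivative of [F] paired through its gradient; exchanging [h] and
    [k] gives the hypothesis of [Omega_symmetric]. *)
Lemma derive2_F w h k : U w -> 'D_k (fun y => 'D_h F y) w =
  dotp h.1 ('D_k grad_q w) + dotp h.2 ('D_k grad_b w).
Proof.
move=> Uw; pose l (v : phase R n) := dotp h.1 v.1 + dotp h.2 v.2.
have ll : linear l.
  move=> c u v; have e1 := dotp_linear h.1 c u.1 v.1.
  have e2 := dotp_linear h.2 c u.2 v.2.
  by rewrite /l scalerDr addrACA; congr (_ + _); [exact: e1|exact: e2].
have dp : differentiable (fun y => (grad_q y, grad_b y)) w.
  by apply: differentiable_pair; [exact: dgq|exact: dgb].
have e := derive_linear_comp k fdP ll dp.
rewrite (derive_eq_on (g := l \o (fun y => (grad_q y, grad_b y))) k oU Uw).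
  by rewrite e (derive_pair k (dgq Uw) (dgb Uw)).
by move=> y Uy; rewrite derive_F.
Qed.

(** By [derive_graph], the vectors [h] on the right are those whose image under
    ['d graph] is vertical; they have the form [(0, a)] with [a] in the left
    kernel of the Hessian. *)
Lemma family_singularP w : U w ->
  hessian (fun b => F (w.1, b)) w.2 \notin unitmx <->
  exists2 h : phase R n, h != 0 & h.1 = 0 /\ 'D_h grad_b w = 0.
Proof.
case: w => q b Uw /=; move Hs : (hessian _ _) => Hm.
have key a : 'D_(0, a) grad_b (q, b) = a *m Hm.
  apply/rowP => i; rewrite derive_row; last exact: dgb.
  have -> : (fun y => grad_b y 0 i) = (fun y => 'D_(0, e_ i) F y).
    by apply/funext => y; rewrite mxE.
  have [_ /(_ (0, e_ i))[/(_ _ Uw) dD _]] := CF 2.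
  rewrite (derive_phase_snd a dD) [RHS]mxE; apply: eq_bigr => j _.
  by rewrite -Hs hessianE.
rewrite det_singularP; split=> [[a a0 aH]|[[h a] /= h0 [h10 Dh]]].
  exists (0, a); last by rewrite key.
  by apply: contra_neq a0 => -[].
subst h; exists a; last by rewrite -key.
by apply: contra_neq h0 => ->.
Qed.

Hypotheses (gb0 : grad_b 0 = 0) (gq0 : grad_q 0 = 0) (F0 : F 0 = 0).

Lemma graph0 : graph 0 = 0.
Proof. by rewrite /graph gb0 gq0. Qed.

Lemma graph_tilde0 : graph_tilde 0 = 0.
Proof. by rewrite /graph_tilde graph0 /graph_z F0 gb0 dotp0 subr0. Qed.

Let fdT : finite_dim (tphase R n).
Proof. by apply: finite_dim_prod; exact: finite_dim_phase. Qed.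
Let fdT' : finite_dim (tphase R n * R)%type.
Proof. by apply: finite_dim_prod => //; exact: finite_dim_R. Qed.
Let lcoord : linear coord. Proof. by move=> k u v. Qed.
Let lcoord' : linear coord_tilde. Proof. by move=> k u v. Qed.

Theorem family_Lagrangian_near : Lagrangian_near (genfam_Lagrangian family) 0.
Proof.
split.
  rewrite -graph0; apply: graph_submanifold fdT oU lcoord smooth_graph _ _ _ U0.
  - by move=> [].
  - exact: family_Lagrangian_graph.
have nU : \forall m \near (0 : tphase R n), U (coord m).
  have cc : {for (0 : tphase R n), continuous coord} by exact: fdT.
  have nU0 : nbhs (coord 0) U by exact: open_nbhs_nbhs.
  exact: cc nU0.
apply: filterS nU => m Um v w Mm.
have mE := (family_Lagrangian_graph Um).1 Mm; rewrite mE.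
have T := @graph_tangentP R n _ _ U graph coord fdT oU lcoord smooth_graph _
  family_Lagrangian_graph _ _ Um.
move=> /T[|h ->]; first by move=> [].
move=> /T[|k ->]; first by move=> [].
have := derive_swap h k oU Um (CF 2).
rewrite (derive2_F h k Um) (derive2_F k h Um).
rewrite (derive_graph h Um) (derive_graph k Um).
exact: Omega_symmetric.
Qed.

Theorem family_Legendrian_near : Legendrian_near (genfam_Legendrian family) 0.
Proof.
split.
  rewrite -graph_tilde0.
  apply: graph_submanifold fdT' oU lcoord' smooth_graph_tilde _ _ _ U0.
  - by move=> [].
  - exact: family_Legendrian_graph.
have nU : \forall m \near (0 : tphase R n * R), U (coord_tilde m).
  have cc : {for (0 : tphase R n * R), continuous coord_tilde} by exact: fdT'.
  have nU0 : nbhs (coord_tilde 0) U by exact: open_nbhs_nbhs.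
  exact: cc nU0.
apply: filterS nU => m Um v Mm.
have mE := (family_Legendrian_graph Um).1 Mm; rewrite mE.
have T := @graph_tangentP R n _ _ U graph_tilde coord_tilde fdT' oU lcoord'
  smooth_graph_tilde _ family_Legendrian_graph _ _ Um.
move=> /T[|h ->]; first by move=> [].
rewrite derive_pair; first last.
- by have [/(_ _ Um)] := smooth_graph_z 1.
- by have [/(_ _ Um)] := smooth_graph 1.
rewrite (derive_graph h Um) (derive_graph_z h Um) /theta /=.
move: ('D_h grad_b _) (grad_q _) => hb gq.
by rewrite (dotpC gq) addrA subrK subrr.
Qed.

Theorem family_Lagrangian_germ :
  image_germ_is_critical_values (fun w => (w.1, grad_b w))
    [set w | hessian (fun b => F (w.1, b)) w.2 \notin unitmx] 0
    (@tpi R n) (genfam_Lagrangian family) 0.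
Proof.
rewrite -graph0.
apply: (graph_image_germ fdT oU lcoord smooth_graph) => //.
- by move=> [].
- exact: family_Lagrangian_graph.
- move=> w Uw /=; rewrite family_singularP //; split=> -[h h0].
    by move=> [h10 Dh]; exists h => //; rewrite derive_graph // /tpi /= h10 Dh.
  by rewrite derive_graph // /tpi /= => -[h10 Dh]; exists h.
Qed.

(** The last coordinate of the velocity is
    [h.1.F_q - b.dF_b], which is zero as soon as the first two are: the vertical
    directions are the same as in the Lagrangian case. *)
Theorem family_Legendrian_germ :
  image_germ_is_critical_values (fun w => ((w.1, grad_b w), graph_z w))
    [set w | hessian (fun b => F (w.1, b)) w.2 \notin unitmx] 0
    (@tpi_tilde R n) (genfam_Legendrian family) 0.
Proof.
rewrite -graph_tilde0.
apply: (graph_image_germ fdT' oU lcoord' smooth_graph_tilde) => //.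
- by move=> [].
- exact: family_Legendrian_graph.
- have D w h : U w -> tpi_tilde ('D_h graph_tilde w) =
      ((h.1, 'D_h grad_b w), dotp h.1 (grad_q w) - dotp w.2 ('D_h grad_b w)).
    move=> Uw; rewrite derive_pair; first last.
    - by have [/(_ _ Uw)] := smooth_graph_z 1.
    - by have [/(_ _ Uw)] := smooth_graph 1.
    by rewrite derive_graph // derive_graph_z.
  move=> w Uw /=; rewrite family_singularP //; split=> -[h h0].
    move=> [h10 Dh]; exists h => //; rewrite D // h10 Dh.
    by rewrite dotp0 dotpC dotp0 subr0.
  by rewrite D // => -[h10 Dh _]; exists h.
Qed.

End GeneratingFunction.

(** * The centre-chord case *)

Section LocalPrimitive.
Variables (R : realType) (n : nat).

Lemma omega_pair (a b c d : 'rV[R]_n) :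
  omega (a, b) (c, d) = dotp a d - dotp c b.
Proof. by rewrite /omega /= (dotpC b). Qed.

(** The mean value theorem on the segment from 0, inside a ball on which the
    partial derivatives agree. *)
Lemma near_eq_of_partials (f g : phase R n -> R) : f 0 = g 0 ->
  (\forall w \near (0 : phase R n), differentiable f w /\ differentiable g w) ->
  (\forall w \near (0 : phase R n), forall i,
    'D_(basis_vec R i, 0) f w = 'D_(basis_vec R i, 0) g w /\
    'D_(0, basis_vec R i) f w = 'D_(0, basis_vec R i) g w) ->
  \forall w \near (0 : phase R n), f w = g w.
Proof.
move=> fg0 nd nD.
have nn : nbhs (0 : phase R n)
    ([set w | differentiable f w /\ differentiable g w] `&` [set w | forall i,
    'D_(basis_vec R i, 0) f w = 'D_(basis_vec R i, 0) g w /\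
    'D_(0, basis_vec R i) f w = 'D_(0, basis_vec R i) g w]) by exact: filterI.
have /nbhs_ballP[r /= r0 Hr] := nn.
apply/nbhs_ballP; exists r => //= w; rewrite -ball_normE /= sub0r normrN => wr.
have inb (t : R) : 0 <= t <= 1 -> ball (0 : phase R n) r (t *: w + 0).
  by move=> t01; exact: ball_segment.
have dfg (t : R) : 0 <= t <= 1 -> differentiable (f - g) (t *: w + 0).
  by move=> /inb/Hr[[df dg] _]; exact: differentiableB.
have [c c01] := MVT_line dfg; have [[df dg] Dfg] := Hr _ (inb _ c01).
rewrite deriveB; do ?[exact: diff_derivable].
have -> : 'D_w f (c *: w + 0) = 'D_w g (c *: w + 0).
  rewrite (derive_phase w df) (derive_phase w dg).
  by congr (_ + _); apply: eq_bigr => i _; congr (_ *: _);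
    [exact: (Dfg i).1|exact: (Dfg i).2].
rewrite subrr addr0 !fctE fg0 subrr subr0 => /eqP.
by rewrite subr_eq0 => /eqP.
Qed.

Lemma smooth_near_differentiable (f : phase R n -> R) :
  smooth_near 0 f -> \forall w \near (0 : phase R n), differentiable f w.
Proof.
move=> [U oU0 Cf]; have := open_nbhs_nbhs oU0; apply: filterS => w Uw.
by have [/(_ w Uw)] := Cf 1.
Qed.

End LocalPrimitive.

Section CenterChord.
Variables (R : realType) (n : nat) (S : 'rV[R]_n -> R) (U0 : set 'rV[R]_n).
Hypotheses (oU0 : open U0) (U00 : U0 0) (CS : smooth_on U0 S).
Hypothesis gS0 : grad S 0 = 0.

Notation e_ i := (basis_vec R (i : 'I_n)).

Definition midpoint_chord (w : phase R n) : phase R n :=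
  (2^-1 *: (w.1 + w.2), 2^-1 *: (w.1 - w.2)).
Definition endpoints (w : phase R n) : phase R n := (w.1 + w.2, w.1 - w.2).
Definition cc_F (w : phase R n) : R := 2^-1 * (S (w.1 + w.2) - S (w.1 - w.2)).

Let plus (w : phase R n) : 'rV[R]_n := w.1 + w.2.
Let minus (w : phase R n) : 'rV[R]_n := w.1 - w.2.
Let Ucc : set (phase R n) := plus @^-1` U0 `&` minus @^-1` U0.
Let fdP : finite_dim (phase R n) := @finite_dim_phase R n.
Let fdr : finite_dim 'rV[R]_n := @finite_dim_rV R n.

Let half_double (a : 'rV[R]_n) : 2^-1 *: (a + a) = a.
Proof. by rewrite -mulr2n -[a *+ 2]scaler_nat scalerA mulVf ?scale1r ?pnatr_eq0. Qed.

Let sum_sub (a b : 'rV[R]_n) : (a + b) + (a - b) = a + a.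
Proof. by rewrite addrACA subrr addr0. Qed.

Let sub_sub (a b : 'rV[R]_n) : (a + b) - (a - b) = b + b.
Proof. by rewrite opprB (addrC b (- a)) addrACA subrr add0r. Qed.

Lemma midpoint_chordK : cancel midpoint_chord endpoints.
Proof.
move=> [u v]; rewrite /endpoints /midpoint_chord /= -scalerDr -scalerBr.
by rewrite sum_sub sub_sub !half_double.
Qed.

Lemma endpointsK : cancel endpoints midpoint_chord.
Proof.
move=> [q b]; rewrite /endpoints /midpoint_chord /=.
by rewrite sum_sub sub_sub !half_double.
Qed.

Let lplus : linear plus.
Proof. by move=> k u v; rewrite /plus /= scalerDr addrACA. Qed.
Let lminus : linear minus.
Proof. by move=> k u v; rewrite /minus /= scalerBr opprD addrACA. Qed.
Let lT : linear midpoint_chord.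
Proof.
move=> k u v; congr (_, _); rewrite /= scalerA mulrC -scalerA -scalerDr;
  congr (_ *: _); [exact: lplus|exact: lminus].
Qed.
Let lT' : linear endpoints.
Proof. by move=> k u v; congr (_, _); [exact: lplus|exact: lminus]. Qed.

Lemma open_Ucc : open Ucc.
Proof.
by apply: openI; apply: open_comp => // w _; [exact: (fdP lplus)|exact: (fdP lminus)].
Qed.

Lemma Ucc0 : Ucc 0.
Proof. by split; rewrite /= /plus /minus /= ?addr0 ?subr0. Qed.

Let dS u : U0 u -> differentiable S u.
Proof. by move=> Uu; have [/(_ u Uu)] := CS 1. Qed.

Lemma pair_smooth (f : 'rV[R]_n -> R) k c : Ck_on k U0 f ->
  Ck_on k Ucc (fun w => 2^-1 * (f (plus w) + c * f (minus w))).
Proof.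
move=> Cf; have oU := open_Ucc; apply: (Ck_onZ _ oU (@finite_dim_R R)).
have Cp : Ck_on k Ucc (f \o plus).
  apply: Ck_on_subset (Ck_on_comp_linear fdP lplus Cf); by move=> w [].
have Cm : Ck_on k Ucc (f \o minus).
  apply: Ck_on_subset (Ck_on_comp_linear fdP lminus Cf); by move=> w [].
exact: (Ck_onD oU Cp (Ck_onZ c oU (@finite_dim_R R) Cm)).
Qed.

(** The case [c = -1] is [cc_F] itself, and its derivatives in the direction of
    the chord are instances of the case [c = 1]. *)
Lemma pair_derive (f : 'rV[R]_n -> R) c w h :
  differentiable f (plus w) -> differentiable f (minus w) ->
  'D_h (fun y => 2^-1 * (f (plus y) + c * f (minus y))) w =
  2^-1 * ('D_(plus h) f (plus w) + c * 'D_(minus h) f (minus w)).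
Proof.
move=> dp dm.
have Dp : differentiable (f \o plus) w.
  apply: differentiable_comp; last exact: dp.
  by have [] := @linear_is_diff _ _ _ plus w fdP lplus.
have Dm : differentiable (f \o minus) w.
  apply: differentiable_comp; last exact: dm.
  by have [] := @linear_is_diff _ _ _ minus w fdP lminus.
rewrite (_ : (fun y => _) = 2^-1 *: ((f \o plus) + c *: (f \o minus))) //.
rewrite deriveZ; last first.
  by apply: derivableD; [|apply: derivableZ]; exact: diff_derivable.
rewrite deriveD; [|exact: diff_derivable|by apply: derivableZ; exact: diff_derivable].
rewrite deriveZ; last exact: diff_derivable.
by rewrite (derive_comp_linear f w h lplus) (derive_comp_linear f w h lminus).
Qed.

Lemma cc_FE : cc_F = (fun w => 2^-1 * (S (plus w) + (-1) * S (minus w))).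
Proof. by apply/funext => w; rewrite mulN1r. Qed.

Lemma cc_F_smooth : smooth_on Ucc cc_F.
Proof. by move=> k; rewrite cc_FE; exact: pair_smooth. Qed.

Let derive_opp u v : U0 u -> 'D_(- v) S u = - 'D_v S u.
Proof. by move=> /dS du; rewrite !deriveE // linearN. Qed.

(** The factor [1] keeps the shape of [pair_derive], which is applied again to
    obtain the Hessian. *)
Lemma cc_partial_b w i : Ucc w ->
  'D_(0, e_ i) cc_F w = 2^-1 * ('D_(e_ i) S (plus w) + 1 * 'D_(e_ i) S (minus w)).
Proof.
move=> [Up Um]; rewrite cc_FE pair_derive; [|exact: dS|exact: dS].
by rewrite /plus /minus /= add0r sub0r derive_opp // mulN1r opprK mul1r.
Qed.

Lemma cc_partial_q w i : Ucc w -> 'D_(e_ i, 0) cc_F w =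
  2^-1 * ('D_(e_ i) S (plus w) + (-1) * 'D_(e_ i) S (minus w)).
Proof.
move=> [Up Um]; rewrite cc_FE pair_derive; [|exact: dS|exact: dS].
by rewrite /plus /minus /= addr0 subr0.
Qed.

Lemma cc_grad_b w : Ucc w ->
  grad_b cc_F w = 2^-1 *: (grad S (plus w) + grad S (minus w)).
Proof.
move=> Uw; apply/rowP => i; rewrite [LHS]mxE (cc_partial_b i Uw) mul1r.
by rewrite [RHS]mxE [X in _ = _ * X]mxE /grad [X in _ = _ * (X + _)]mxE
  [X in _ = _ * (_ + X)]mxE.
Qed.

Lemma cc_grad_q w : Ucc w ->
  grad_q cc_F w = 2^-1 *: (grad S (plus w) - grad S (minus w)).
Proof.
move=> Uw; apply/rowP => i; rewrite [LHS]mxE (cc_partial_q i Uw) mulN1r.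
rewrite [RHS]mxE [X in _ = _ * X]mxE /grad [X in _ = _ * (X + _)]mxE.
by rewrite [X in _ = _ * (_ + X)]mxE [X in _ = _ * (_ - X)]mxE.
Qed.

Lemma cc_hessian w : Ucc w -> hessian (fun b => cc_F (w.1, b)) w.2 =
  2^-1 *: (hessian S (plus w) - hessian S (minus w)).
Proof.
move=> Uw; apply/matrixP => i j.
have e y : Ucc y -> 'D_(0, e_ j) cc_F y =
    2^-1 * ('D_(e_ j) S (plus y) + 1 * 'D_(e_ j) S (minus y)).
  exact: cc_partial_b.
have dD u : U0 u -> differentiable (fun b => 'D_(e_ j) S b) u.
  by move=> Uu; have [_ /(_ (e_ j))[/(_ u Uu)]] := CS 2.
have Up : U0 (plus w) by case: Uw.
have Um : U0 (minus w) by case: Uw.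
rewrite [LHS](hessianE cc_F w.1 w.2 i j) -surjective_pairing.
apply: etrans (derive_eq_on (0, e_ i) open_Ucc Uw e) _.
apply: etrans (@pair_derive (fun b => 'D_(e_ j) S b) 1 w (0, e_ i)
  (dD _ Up) (dD _ Um)) _.
have -> : plus (0, e_ i) = e_ i by rewrite /plus /= add0r.
have -> : minus (0, e_ i) = - e_ i by rewrite /minus /= sub0r.
rewrite mul1r.
have -> : 'D_(- e_ i) (fun b => 'D_(e_ j) S b) (minus w) =
    - 'D_(e_ i) (fun b => 'D_(e_ j) S b) (minus w).
  by rewrite !deriveE ?linearN //; exact: dD.
rewrite [RHS]mxE [X in _ = _ * X]mxE /hessian [X in _ = _ * (X + _)]mxE.
by rewrite [X in _ = _ * (_ + X)]mxE [X in _ = _ * (_ - X)]mxE.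
Qed.

Lemma plus_midpoint w : plus (midpoint_chord w) = w.1.
Proof. by have := congr1 fst (midpoint_chordK w). Qed.

Lemma minus_midpoint w : minus (midpoint_chord w) = w.2.
Proof. by have := congr1 snd (midpoint_chordK w). Qed.

(** In the coordinates (midpoint, half chord) the centre-chord map is the
    projection of the graph of [cc_F]. *)
Lemma cc_xE w : Ucc (midpoint_chord w) ->
  cc_x S w = ((midpoint_chord w).1, grad_b cc_F (midpoint_chord w)).
Proof. by move=> /cc_grad_b ->; rewrite plus_midpoint minus_midpoint. Qed.

Lemma cc_yE w : Ucc (midpoint_chord w) ->
  cc_y S w = ((midpoint_chord w).2, grad_q cc_F (midpoint_chord w)).
Proof. by move=> /cc_grad_q ->; rewrite plus_midpoint minus_midpoint. Qed.

Lemma cc_singularE w : Ucc (midpoint_chord w) -> cc_singular S w <->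
  hessian (fun b => cc_F ((midpoint_chord w).1, b)) (midpoint_chord w).2
    \notin unitmx.
Proof.
move=> /cc_hessian ->; rewrite plus_midpoint minus_midpoint /cc_singular /=.
by rewrite unitmxZ // unitfE invr_eq0 pnatr_eq0.
Qed.

Let nearU : \forall w \near (0 : phase R n), Ucc (midpoint_chord w).
Proof.
have cc : {for (0 : phase R n), continuous midpoint_chord} by exact: fdP.
have nU : nbhs (midpoint_chord 0) Ucc.
  apply: open_nbhs_nbhs; split; first exact: open_Ucc.
  rewrite (_ : midpoint_chord 0 = 0); first exact: Ucc0.
  by have [g ->] := linear_packing lT; rewrite linear0.
exact: cc nU.
Qed.

Let T0 : midpoint_chord 0 = 0.
Proof. by have [g ->] := linear_packing lT; rewrite linear0. Qed.

Lemma cc_F_grad_b0 : grad_b cc_F 0 = 0.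
Proof.
rewrite (cc_grad_b Ucc0) /plus /minus /= addr0 subr0 gS0.
by rewrite addr0 scaler0.
Qed.

Lemma cc_F_grad_q0 : grad_q cc_F 0 = 0.
Proof.
by rewrite (cc_grad_q Ucc0) /plus /minus /= addr0 subr0 subrr scaler0.
Qed.

Lemma cc_F0 : cc_F 0 = 0.
Proof. by rewrite /cc_F /= addr0 subr0 subrr mulr0. Qed.

Definition cc_f (w : phase R n) : R := graph_z cc_F (midpoint_chord w).

(** Along [k = midpoint_chord h] the derivative of [cc_f] is
    [k.1.F_q - b.dF_b(k)], which is the pairing of [x' = (k.1, dF_b(k))] with
    [y = (b, F_q)]. *)
Lemma derive_cc_f w h : Ucc (midpoint_chord w) ->
  'D_h cc_f w = omega ('D_h (cc_x S) w) (cc_y S w).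
Proof.
move=> Uw; set oUcc := open_Ucc.
have oT : open (midpoint_chord @^-1` Ucc).
  by apply: open_comp => // x _; exact: (fdP lT).
pose k := midpoint_chord h.
have Dz : 'D_h cc_f w = 'D_k (graph_z cc_F) (midpoint_chord w).
  exact: (derive_comp_linear (graph_z cc_F) w h lT).
pose X (v : phase R n) := (v.1, grad_b cc_F v).
have dX1 : differentiable (fst : phase R n -> 'rV[R]_n) (midpoint_chord w).
  by have [] := @linear_is_diff _ _ _ (fst : phase R n -> 'rV[R]_n)
    (midpoint_chord w) fdP (fun _ _ _ => erefl).
have dX2 : differentiable (grad_b cc_F) (midpoint_chord w).
  by have [/(_ _ Uw)] := smooth_grad_b oUcc cc_F_smooth 1.
have DX : 'D_h (cc_x S) w = (k.1, 'D_k (grad_b cc_F) (midpoint_chord w)).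
  rewrite (derive_eq_on (g := X \o midpoint_chord) h oT Uw).
    rewrite (derive_comp_linear X w h lT) (derive_pair _ dX1 dX2).
    congr (_, _).
    exact: (derive_linear (l := fst : phase R n -> 'rV[R]_n) _ _ fdP
      (fun _ _ _ => erefl)).
  by move=> y Uy; rewrite cc_xE.
rewrite DX (cc_yE Uw) omega_pair.
exact: etrans Dz (derive_graph_z oUcc cc_F_smooth k Uw).
Qed.

Lemma cc_f_height : cc_height S cc_f.
Proof.
split.
- exists (midpoint_chord @^-1` Ucc).
    split; last by rewrite /= T0; exact: Ucc0.
    by apply: open_comp; [move=> x _; exact: (fdP lT)|exact: open_Ucc].
  move=> k; have := smooth_graph_z open_Ucc cc_F_smooth k.
  exact: Ck_on_comp_linear.
- near=> u; rewrite /cc_f /graph_z /midpoint_chord /= subrr scaler0.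
  by rewrite dotpC dotp0 subr0 /cc_F /= addr0 subr0 subrr mulr0.
- by apply: filterS nearU => w Uw i; split; exact: derive_cc_f.
Unshelve. all: by end_near. Qed.

Lemma cc_height_unique f :
  cc_height S f -> \forall w \near (0 : phase R n), f w = cc_f w.
Proof.
move=> [sf f0 Df]; have [s0 f00 D0] := cc_f_height.
apply: near_eq_of_partials.
- by have := nbhs_singleton f0; have := nbhs_singleton f00 => /= -> ->.
- by apply: filterI; exact: smooth_near_differentiable.
- apply: filterS2 Df D0 => w H H0 i.
  have [-> ->] := H i; have [h1 h2] := H0 i.
  by split; [exact: esym h1|exact: esym h2].
Qed.

Lemma cc_conclusion :
  [/\ Lagrangian_near (genfam_Lagrangian (G_cc S)) 0,
      image_germ_is_critical_values (cc_x S) (cc_singular S) 0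
        (@tpi R n) (genfam_Lagrangian (G_cc S)) 0,
      Legendrian_near (genfam_Legendrian (G_cc S)) 0,
      (exists f, cc_height S f)
    & forall f, cc_height S f ->
      image_germ_is_critical_values (fun w => (cc_x S w, f w))
        (cc_singular S) 0
        (@tpi_tilde R n) (genfam_Legendrian (G_cc S)) 0].
Proof.
have H := cc_F_grad_b0; have H' := cc_F_grad_q0; have H0 := cc_F0.
have oU := open_Ucc; have C := cc_F_smooth; have UU := Ucc0.
rewrite -[G_cc S]/(family cc_F); split.
- exact: (family_Lagrangian_near oU).
- have G := family_Lagrangian_germ oU UU C H H'.
  apply: (image_germ_reparam (fdP lT) (fdP lT') midpoint_chordK endpointsK T0 _ G).
  by apply: filterS nearU => w Uw; split; [exact: cc_xE|exact: cc_singularE].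
- exact: (family_Legendrian_near oU).
- by exists cc_f; exact: cc_f_height.
- move=> f /cc_height_unique fE.
  have G := family_Legendrian_germ oU UU C H H' H0.
  apply: (image_germ_reparam (fdP lT) (fdP lT') midpoint_chordK endpointsK T0 _ G).
  apply: filterS2 nearU fE => w Uw fw; split; last exact: cc_singularE.
  by rewrite (cc_xE Uw) fw.
Qed.

End CenterChord.

(** * Majorants and termwise differentiation *)

Section NonnegativePolynomials.
Variable R : realType.
Implicit Types (p q : {poly R}) (x y d : R).

Definition nneg_coefs p : Prop := forall i, 0 <= p`_i.

Lemma nneg_coefsC c : 0 <= c -> nneg_coefs c%:P.
Proof. by move=> c0 i; rewrite coefC; case: ifP. Qed.

Lemma nneg_coefsX : nneg_coefs 'X.
Proof. by move=> i; rewrite coefX ler0n. Qed.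

Lemma nneg_coefsD p q : nneg_coefs p -> nneg_coefs q -> nneg_coefs (p + q).
Proof. by move=> hp hq i; rewrite coefD addr_ge0. Qed.

Lemma nneg_coefsM p q : nneg_coefs p -> nneg_coefs q -> nneg_coefs (p * q).
Proof.
by move=> hp hq i; rewrite coefM; apply: sumr_ge0 => j _; exact: mulr_ge0.
Qed.

Lemma nneg_coefsZ c p : 0 <= c -> nneg_coefs p -> nneg_coefs (c *: p).
Proof. by move=> c0 hp i; rewrite coefZ mulr_ge0. Qed.

Lemma nneg_coefs_deriv p : nneg_coefs p -> nneg_coefs p^`().
Proof. by move=> hp i; rewrite coef_deriv mulrn_wge0. Qed.

Lemma horner_nneg p x : nneg_coefs p -> 0 <= x -> 0 <= p.[x].
Proof.
move=> hp x0; rewrite horner_coef; apply: sumr_ge0 => i _.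
by rewrite mulr_ge0 ?exprn_ge0.
Qed.

Lemma horner_nneg_mono p x y :
  nneg_coefs p -> 0 <= x -> x <= y -> p.[x] <= p.[y].
Proof.
move=> hp x0 xy; rewrite !horner_coef; apply: ler_sum => i _.
by rewrite ler_wpM2l // lerXn2r // nnegrE (le_trans x0).
Qed.

(** The second term of the Taylor expansion at [x], all of whose terms are
    nonnegative.  This is how a bound on a majorant yields one on its
    derivative, at the price of a smaller radius. *)
Lemma deriv_nneg_le p x d : nneg_coefs p -> 0 <= x -> 0 <= d ->
  d * p^`().[x] <= p.[x + d].
Proof.
move=> hp x0 d0; elim/poly_ind: p hp => [|p c IH] hp.
  by rewrite derivC !horner0 mulr0.
have hp' : nneg_coefs p.
  by move=> i; have := hp i.+1; rewrite coefD coefMX coefC /= addr0.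
have c0 : 0 <= c by have := hp 0%N; rewrite coefD coefMX coefC /= add0r.
rewrite derivD derivC addr0 derivM derivX mulr1 !hornerE.
have h1 := IH hp'.
have h2 : p.[x] <= p.[x + d] by apply: horner_nneg_mono => //; rewrite lerDl.
have h1x := ler_wpM2r x0 h1; have h2d := ler_wpM2l d0 h2.
rewrite mulrDr; nra.
Qed.

End NonnegativePolynomials.

Section Majorants.
Variables (R : realType) (V : normedModType R).
Hypothesis fdV : finite_dim V.
Implicit Types (u w : V -> R) (A B : {poly R}).

(** The method of majorants: a bound on [u] by a polynomial in the norm which
    survives differentiation, ['D_v u] being bounded by [`|v|] times the
    derivative of that polynomial, up to order [k].  The recursion follows that
    of [Ck_on]. *)
Fixpoint majorized k u A : Prop :=
  (forall h, `|u h| <= A.[`|h|]) /\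
  if k is k'.+1 then (forall h, differentiable u h) /\
    (forall v, majorized k' (fun h => 'D_v u h) (`|v| *: A^`()))
  else True.

Lemma majorizedS k u A : majorized k.+1 u A -> majorized k u A.
Proof.
elim: k u A => [|k IH] u A; first by case.
by move=> [hu [du Du]]; split=> //; split=> // v; exact: IH.
Qed.

Lemma majorized_cst k c b : `|c| <= b -> majorized k (cst c) b%:P.
Proof.
elim: k c b => [|k IH] c b cb; split=> [h|] //; rewrite ?hornerC //.
split=> [h|v]; first exact: differentiable_cst.
rewrite (_ : (fun h => _) = cst 0); last first.
  by apply/funext => h; exact: derive_cst.
by rewrite derivC scaler0; apply: IH; rewrite normr0.
Qed.

Lemma majorized_linear k (l : V -> R) :
  linear l -> (forall h, `|l h| <= `|h|) -> majorized k l 'X.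
Proof.
move=> ll hl; case: k => [|k]; split=> [h|] //; rewrite ?hornerX //.
split=> [h|v]; first by have [] := @linear_is_diff _ _ _ l h fdV ll.
rewrite (_ : (fun h => _) = cst (l v)); last first.
  by apply/funext => h; exact: derive_linear.
by rewrite derivX -mul_polyC mulr1; exact: majorized_cst.
Qed.

Lemma majorizedD k u w A B :
  majorized k u A -> majorized k w B -> majorized k (u + w) (A + B).
Proof.
elim: k u w A B => [|k IH] u w A B [hu Hu] [hw Hw]; split=> [h|] //.
- by rewrite hornerD (le_trans (ler_normD _ _)) // lerD.
- by rewrite hornerD (le_trans (ler_normD _ _)) // lerD.
case: Hu Hw => du Du [dw Dw]; split=> [h|v]; first exact: differentiableD.
rewrite (_ : (fun h => _) = (fun h => 'D_v u h) + (fun h => 'D_v w h)).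
  by rewrite derivD scalerDr; apply: IH; [exact: Du|exact: Dw].
by apply/funext => h; rewrite deriveD //; apply: diff_derivable.
Qed.

Lemma majorizedM k u w A B :
  majorized k u A -> majorized k w B -> majorized k (u * w) (A * B).
Proof.
elim: k u w A B => [|k IH] u w A B; first move=> [hu _] [hw _].
  by split=> // h; rewrite hornerM normrM ler_pM.
move=> Mu Mw; have [hu [du Du]] := Mu; have [hw [dw Dw]] := Mw.
split=> [h|]; first by rewrite hornerM normrM ler_pM.
split=> [h|v]; first exact: differentiableM.
rewrite (_ : (fun h => _) =
    u * (fun h => 'D_v w h) + w * (fun h => 'D_v u h)); last first.
  by apply/funext => h; rewrite deriveM //; apply: diff_derivable.
rewrite (_ : `|v| *: (A * B)^`() =
    A * (`|v| *: B^`()) + B * (`|v| *: A^`())); last first.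
  by rewrite derivM scalerDr addrC -!scalerAr (mulrC B).
by apply: majorizedD; apply: IH; [exact: majorizedS|exact: Dw
  |exact: majorizedS|exact: Du].
Qed.

End Majorants.

Section DominatedSeries.
Variable R : realType.
Implicit Types a b : R ^nat.

Definition bounded_series a := exists M, forall m, series a m <= M.

Lemma dominated_cvg a b :
  (forall n, `|a n| <= b n) -> bounded_series b -> cvgn (series a).
Proof.
move=> ab [M bM]; have b0 n : 0 <= b n := le_trans (normr_ge0 _) (ab n).
apply: normed_cvg; apply: (@series_le_cvg _ _ b) => // [n|].
  exact: normr_ge0.
apply: nondecreasing_is_cvgn; first exact: nondecreasing_series.
by exists M => _ [m _ <-].
Qed.

Lemma cvg_norm_le (s : R ^nat) l M :
  s @ \oo --> l -> (forall n, `|s n| <= M) -> `|l| <= M.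
Proof.
move=> sl sM; apply/ler_addgt0Pr => e e0.
have /cvgrPdist_le/(_ _ e0)[n _ /(_ n (leqnn n)) ln] := sl.
by rewrite -[l](subrK (s n)) addrC (le_trans (ler_normD _ _)) // lerD.
Qed.

Lemma norm_series_le a b M m :
  (forall n, `|a n| <= b n) -> series b m <= M -> `|series a m| <= M.
Proof.
move=> ab; apply: le_trans; rewrite /series /=.
by rewrite (le_trans (ler_norm_sum _ _ _)) // ler_sum.
Qed.

Lemma bounded_seriesZ c a :
  0 <= c -> bounded_series a -> bounded_series (fun n => c * a n).
Proof.
move=> c0 [M aM]; exists (c * M) => m.
by rewrite /series /= -mulr_sumr ler_wpM2l //; exact: aM.
Qed.

Lemma bounded_series_le a b :
  (forall n, a n <= b n) -> bounded_series b -> bounded_series a.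
Proof.
move=> ab [M bM]; exists M => m; apply: le_trans (bM m).
by rewrite /series /= ler_sum.
Qed.

End DominatedSeries.

Section TermwiseDifferentiation.
Variables (R : realType) (V : normedModType R).
Hypothesis fdV : finite_dim V.

(** Two applications of the mean value theorem express the remainder as a second
    derivative of [u] at an intermediate point, in the directions [k] and
    [c *: k]. *)
Lemma majorized_taylor (u : V -> R) (A : {poly R}) h k s :
  nneg_coefs A -> majorized 2 u A -> `|h| + `|k| <= s ->
  `|u (k + h) - u h - 'D_k u h| <= `|k| ^+ 2 * A^`()^`().[s].
Proof.
move=> A0 [_ [du /(_ k)[_ [dDu DDu]]]] hks.
have [c c01 ->] : exists2 c, 0 <= c <= 1 & u (k + h) - u h = 'D_k u (c *: k + h).
  by apply: MVT_line => t _; exact: du.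
have [c' c'01 ->] : exists2 c', 0 <= c' <= 1 & 'D_k u (c *: k + h) - 'D_k u h =
   'D_(c *: k) (fun y => 'D_k u y) (c' *: (c *: k) + h).
  by apply: (@MVT_line _ _ (fun y => 'D_k u y)) => t _; exact: dDu.
have [+ _] := DDu (c *: k) => /(_ (c' *: (c *: k) + h)) H.
apply: le_trans H _.
have A20 : nneg_coefs A^`()^`() by do 2!apply: nneg_coefs_deriv.
rewrite derivZ !hornerZ.
have [/andP[c0 c1] /andP[c'0 c'1]] := (c01, c'01).
have ck : `|c *: k| <= `|k| by rewrite normrZ (ger0_norm c0) ler_piMl.
have arg : `|c' *: (c *: k) + h| <= s.
  apply: le_trans hks; rewrite addrC (le_trans (ler_normD _ _)) // lerD2l.
  by rewrite normrZ (ger0_norm c'0) (le_trans _ ck) // ler_piMl.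
rewrite mulrA expr2 ler_pM ?mulr_ge0 ?normr_ge0 ?horner_nneg //.
  by rewrite ler_wpM2r.
exact: horner_nneg_mono.
Qed.

(** Series that converge absolutely together with all their derivatives, and
    uniformly on smaller balls; unlike power series they are given by terms
    with no prescribed degree. *)
Definition majorized_series (rho : R) (u : nat -> V -> R) (A : nat -> {poly R}) :=
  [/\ forall k N, majorized k (u N) (A N), forall N, nneg_coefs (A N)
    & forall r, 0 <= r -> r < rho -> bounded_series (fun N => (A N).[r])].

(** Apply [deriv_nneg_le] halfway between [r] and [rho]. *)
Lemma bounded_deriv rho (A : nat -> {poly R}) : (forall N, nneg_coefs (A N)) ->
  (forall r, 0 <= r -> r < rho -> bounded_series (fun N => (A N).[r])) ->
  forall r, 0 <= r -> r < rho -> bounded_series (fun N => (A N)^`().[r]).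
Proof.
move=> A0 bA r r0 rr; pose d := (rho - r) / 2.
have d0 : 0 < d by rewrite divr_gt0 // subr_gt0.
have rd : r + d < rho by rewrite /d; lra.
have := bounded_seriesZ (ltW (_ : 0 < d^-1)) (bA _ (addr_ge0 r0 (ltW d0)) rd).
rewrite invr_gt0 => /(_ d0); apply: bounded_series_le => N.
rewrite -(ler_pM2l d0) mulrA divff ?mul1r ?gt_eqF //.
by apply: deriv_nneg_le => //; exact: ltW.
Qed.

Lemma majorized_series_deriv rho u A v : majorized_series rho u A ->
  majorized_series rho (fun N h => 'D_v (u N) h) (fun N => `|v| *: (A N)^`()).
Proof.
move=> [Mu A0 bA]; split=> [k N|N|r r0 rr].
- by have [_ [_]] := Mu k.+1 N; apply.
- by apply: nneg_coefsZ => //; exact: nneg_coefs_deriv.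
- have := bounded_seriesZ (normr_ge0 v) (bounded_deriv A0 bA r0 rr).
  by apply: bounded_series_le => N; rewrite hornerZ.
Qed.

Lemma majorized_series_cvg rho u A h : majorized_series rho u A -> `|h| < rho ->
  cvgn (series (fun N => u N h)).
Proof.
move=> [Mu A0 bA] hr; apply: dominated_cvg (bA _ (normr_ge0 h) hr) => N.
by have [] := Mu 0%N N.
Qed.

(** The second order remainders of the terms are at most [`|k| ^+ 2] times the
    second derivatives of the majorants, whose sum is bounded slightly beyond
    [`|h|]; so the sum of the remainders is [O(`|k| ^+ 2)]. *)
Lemma majorized_series_derive rho u A f : majorized_series rho u A ->
  (forall h, `|h| < rho -> series (fun N => u N h) @ \oo --> f h) ->
  forall h, `|h| < rho -> differentiable f h /\
    forall v, series (fun N => 'D_v (u N) h) @ \oo --> 'D_v f h.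
Proof.
move=> MS uf h hr; have [Mu A0 bA] := MS.
pose L v := limn (series (fun N => 'D_v (u N) h)).
have cD v : series (fun N => 'D_v (u N) h) @ \oo --> L v.
  exact: (majorized_series_cvg (majorized_series_deriv v MS) hr).
have du N : differentiable (u N) h by have [_ []] := Mu 1%N N.
have lL : linear L.
  move=> c v w; apply: cvg_lim => //.
  have -> : series (fun N => 'D_(c *: v + w) (u N) h) = (fun m =>
      c * series (fun N => 'D_v (u N) h) m + series (fun N => 'D_w (u N) h) m).
    apply/funext => m; rewrite /series /= mulr_sumr -big_split.
    by apply: eq_bigr => N _; exact: (derive_dir_linear (du N) c v w).
  by apply: cvgD => //; exact: cvgMl_tmp.
pose d := (rho - `|h|) / 2.
have d0 : 0 < d by rewrite divr_gt0 // subr_gt0.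
have hd : `|h| + d < rho by rewrite /d; lra.
have hd0 : 0 <= `|h| + d by rewrite addr_ge0 // ltW.
have A'0 N : nneg_coefs (A N)^`() by exact: nneg_coefs_deriv.
have [M bM] := bounded_deriv A'0 (bounded_deriv A0 bA) hd0 hd.
have M0 : 0 <= M by have := bM 0%N; rewrite /series /= big_geq.
have est k : `|k| <= d -> `|f (k + h) - f h - L k| <= `|k| ^+ 2 * M.
  move=> kd; have khr : `|k + h| < rho.
    by rewrite (le_lt_trans (ler_normD _ _)) // addrC (le_lt_trans _ hd) // lerD2l.
  have C : series (fun N => u N (k + h) - u N h - 'D_k (u N) h) @ \oo -->
      f (k + h) - f h - L k.
    rewrite (_ : series _ = series (fun N => u N (k + h)) -
        series (fun N => u N h) - series (fun N => 'D_k (u N) h)).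
      exact: cvgB (cvgB (uf _ khr) (uf _ hr)) (cD k).
    by apply/funext => m; rewrite !fctE /series /= !sumrB.
  apply: (cvg_norm_le C) => m.
  apply: (@norm_series_le _ _ (fun N => `|k| ^+ 2 * (A N)^`()^`().[`|h| + d])).
    by move=> N; apply: majorized_taylor => //; rewrite lerD2l.
  by rewrite /series /= -mulr_sumr ler_wpM2l ?exprn_ge0 //; exact: bM.
have D : is_diff h f L.
  apply: is_diff_eps => //; first exact: fdV.
  move=> e e0; apply/nbhs_ballP; exists (Num.min d (e / (M + 1))) => /=.
    by rewrite lt_min d0 divr_gt0 // ltr_wpDl.
  move=> k; rewrite -ball_normE /= sub0r normrN lt_min => /andP[kd ke].
  rewrite (le_trans (est _ (ltW kd))) // expr2 mulrAC ler_wpM2r //.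
  have M1 : 0 < M + 1 by rewrite ltr_wpDl.
  rewrite ltr_pdivlMr // in ke; rewrite (le_trans _ (ltW ke)) //.
  by rewrite ler_wpM2l // lerDl.
split=> [|v]; first by case: D.
rewrite deriveE; last by case: D.
by rewrite (@diff_val _ _ _ _ _ _ _ D).
Qed.

Lemma open_norm_lt (rho : R) : open [set h : V | `|h| < rho].
Proof.
rewrite openE => h /= hr; apply/nbhs_ballP; exists (rho - `|h|) => /=.
  by rewrite subr_gt0.
move=> y; rewrite -ball_normE /= => hy.
by rewrite -[y](subrK h) (le_lt_trans (ler_normD _ _)) // distrC -ltrBrDr.
Qed.

(** The derivatives of a majorized series form a majorized series with the same
    [rho], so the argument can be iterated. *)
Theorem majorized_series_smooth rho u A f : majorized_series rho u A ->
  (forall h, `|h| < rho -> series (fun N => u N h) @ \oo --> f h) ->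
  smooth_on [set h : V | `|h| < rho] f.
Proof.
move=> MS uf k; elim: k u A f MS uf => [|k IH] u A f MS uf /=.
  move=> h hr; apply: differentiable_continuous.
  by have [] := majorized_series_derive MS uf hr.
split=> [h hr|v]; first by have [] := majorized_series_derive MS uf hr.
apply: (IH _ _ _ (majorized_series_deriv v MS)) => h hr.
by have [_] := majorized_series_derive MS uf hr; apply.
Qed.

End TermwiseDifferentiation.

(** * Power series as majorized series *)

Section CubeBlocks.
Variables (n : nat) (W : zmodType).

(** The multi-indices in the cube of side [N] but not in that of side [N.-1].
    The whole cube is taken for [N = 0]: in dimension [n = 0] the empty cube has
    one element, which must be counted once. *)
Definition outer_shell N (a : {ffun 'I_n -> 'I_N}) : bool :=
  (N == 0)%N || ~~ [forall i, (a i).+1 < N]%N.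

(** For [N = 0] there may be no map from the large cube to the small one, hence
    the partial inverse of the inclusion. *)
Lemma cube_widen N (G : ('I_n -> nat) -> W) :
  \sum_(a : {ffun 'I_n -> 'I_N.+1} | [forall i, (a i).+1 < N.+1]%N)
     G (fun i => a i : nat) =
  \sum_(a : {ffun 'I_n -> 'I_N}) G (fun i => a i : nat).
Proof.
pose h (b : {ffun 'I_n -> 'I_N}) : {ffun 'I_n -> 'I_N.+1} :=
  [ffun i => widen_ord (leqnSn N) (b i)].
have hinj : injective h.
  move=> b b' /ffunP e; apply/ffunP => i; apply: val_inj.
  by have := congr1 val (e i); rewrite !ffunE.
rewrite (reindex_omap h (fun a => [pick b | h b == a])) /=; last first.
  move=> a /forallP aN; case: pickP => [b /eqP <- //|nob].
  have aN' i : (a i < N)%N := aN i.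
  have /eqP[] := nob [ffun i => Ordinal (aN' i)]; apply/ffunP => i.
  by apply: val_inj; rewrite !ffunE.
apply: eq_big => [b|b _].
  case: pickP => [b' /eqP/hinj ->|/(_ b)]; last by rewrite eqxx.
  by rewrite eqxx andbT; apply/forallP => i; rewrite ffunE /= ltnS.
by congr G; apply/funext => i; rewrite ffunE.
Qed.

(** Cubes are disjoint unions of shells, so the partial sums of the power
    series over cubes are those of an ordinary series. *)
Lemma cube_shells m (G : ('I_n -> nat) -> W) :
  \sum_(N < m.+1) \sum_(a : {ffun 'I_n -> 'I_N} | outer_shell a)
     G (fun i => a i : nat) =
  \sum_(a : {ffun 'I_n -> 'I_m}) G (fun i => a i : nat).
Proof.
elim: m => [|m IH]; first by rewrite big_ord1; apply: eq_bigl.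
rewrite big_ord_recr /= IH -cube_widen.
rewrite [RHS](bigID (fun a : {ffun 'I_n -> 'I_m.+1} =>
  [forall i, (a i).+1 < m.+1]%N)) /=.
by congr (_ + _); apply: eq_bigl.
Qed.

End CubeBlocks.

Section HolomorphicMajorants.
Variables (R : realType) (n : nat).
Local Notation P := (phase R n).
Implicit Types (p q : P -> R[i]) (A B : {poly R}).

Let fdP : finite_dim P := @finite_dim_phase R n.

Definition cauchy_riemann p := forall w (v : 'rV[R]_n),
  'D_(0, v) (fun x => complex.Im (p x)) w =
    'D_(v, 0) (fun x => complex.Re (p x)) w /\
  'D_(0, v) (fun x => complex.Re (p x)) w =
    - 'D_(v, 0) (fun x => complex.Im (p x)) w.

(** The factor 1/2 makes majorants multiplicative: the real part of a product
    is a sum of two terms, each majorized by [(A / 2) * (B / 2)], and so is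
    itself majorized by [(A * B) / 2]. *)
Definition holo_majorized p A :=
  [/\ forall k, majorized k (fun w => complex.Re (p w)) (2^-1 *: A),
      forall k, majorized k (fun w => complex.Im (p w)) (2^-1 *: A),
      nneg_coefs A & cauchy_riemann p].

Lemma majorized_derivable (u : P -> R) A :
  (forall k, majorized k u A) -> forall w v, derivable u w v.
Proof. by move=> /(_ 1%N)[_ [du _]] w v; exact: diff_derivable. Qed.

Let real_CR (a b : P -> R) w (v : 'rV[R]_n) :=
  'D_(0, v) b w = 'D_(v, 0) a w /\ 'D_(0, v) a w = - 'D_(v, 0) b w.

Lemma real_CR_D (a b c d : P -> R) w v :
  (forall v', derivable a w v') -> (forall v', derivable b w v') ->
  (forall v', derivable c w v') -> (forall v', derivable d w v') ->
  real_CR a b w v -> real_CR c d w v -> real_CR (a + c) (b + d) w v.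
Proof.
move=> da db dc dd [ab ba] [cd dc']; split.
  by rewrite (deriveD (db _) (dd _)) (deriveD (da _) (dc _)) ab cd.
by rewrite (deriveD (db _) (dd _)) (deriveD (da _) (dc _)) ba dc' opprD.
Qed.

Lemma real_CR_M (a b c d : P -> R) w v :
  (forall v', derivable a w v') -> (forall v', derivable b w v') ->
  (forall v', derivable c w v') -> (forall v', derivable d w v') ->
  real_CR a b w v -> real_CR c d w v ->
  real_CR (a * c - b * d) (a * d + b * c) w v.
Proof.
move=> da db dc dd [ab ba] [cd dc'].
have DR v' : 'D_v' (a * c - b * d) w = a w * 'D_v' c w + c w * 'D_v' a w
    - (b w * 'D_v' d w + d w * 'D_v' b w).
  rewrite (deriveB (derivableM (da _) (dc _)) (derivableM (db _) (dd _))).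
  by rewrite (deriveM (da _) (dc _)) (deriveM (db _) (dd _)).
have DI v' : 'D_v' (a * d + b * c) w = a w * 'D_v' d w + d w * 'D_v' a w
    + (b w * 'D_v' c w + c w * 'D_v' b w).
  rewrite (deriveD (derivableM (da _) (dd _)) (derivableM (db _) (dc _))).
  by rewrite (deriveM (da _) (dd _)) (deriveM (db _) (dc _)).
split; rewrite DR DI ab ba cd dc'; set x1 := 'D_(v, 0) a w;
  set x2 := 'D_(v, 0) b w; set x3 := 'D_(v, 0) c w; set x4 := 'D_(v, 0) d w;
  clearbody x1 x2 x3 x4; ring.
Qed.

Lemma norm_Re_le (z : R[i]) : `|complex.Re z| <= Normc.normc z.
Proof.
by have := normc_ge_Re z; rewrite lecR; case: z.
Qed.

Lemma norm_Im_le (z : R[i]) : `|complex.Im z| <= Normc.normc z.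
Proof.
case: z => a b /=; rewrite -sqrtr_sqr; apply: ler_wsqrtr.
by rewrite lerDr sqr_ge0.
Qed.

Lemma normc_le (z : R[i]) :
  Normc.normc z <= `|complex.Re z| + `|complex.Im z|.
Proof.
case: z => a b /=; rewrite -[leRHS]ger0_norm ?addr_ge0 // -sqrtr_sqr.
rewrite ler_wsqrtr // -(real_normK (num_real a)) -(real_normK (num_real b)).
by rewrite sqrrD addrAC lerDl mulrn_wge0 // mulr_ge0.
Qed.

Lemma holo_majorized_cst c :
  holo_majorized (cst c) (2 * Normc.normc c)%:P.
Proof.
have e : 2^-1 *: (2 * Normc.normc c)%:P = (Normc.normc c)%:P.
  by rewrite -mul_polyC -polyCM mulrA mulVf ?mul1r // pnatr_eq0.
split; rewrite ?e.
- by move=> k; exact: majorized_cst (norm_Re_le c).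
- by move=> k; exact: majorized_cst (norm_Im_le c).
- apply: nneg_coefsC; rewrite mulr_ge0 // (le_trans _ (norm_Re_le c)) //.
- move=> w v.
  by rewrite !(derive_cst _ _ _ : 'D__ (fun _ => _) _ = 0) oppr0.
Qed.

Lemma holo_majorizedD p q A B : holo_majorized p A -> holo_majorized q B ->
  holo_majorized (fun w => p w + q w) (A + B).
Proof.
move=> [Rp Ip A0 Cp] [Rq Iq B0 Cq].
have eR : (fun w => complex.Re (p w + q w)) =
    (fun w => complex.Re (p w)) + (fun w => complex.Re (q w)).
  by apply/funext => w; rewrite fctE; case: (p w); case: (q w).
have eI : (fun w => complex.Im (p w + q w)) =
    (fun w => complex.Im (p w)) + (fun w => complex.Im (q w)).
  by apply/funext => w; rewrite fctE; case: (p w); case: (q w).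
split.
- by move=> k; rewrite eR scalerDr; exact: majorizedD.
- by move=> k; rewrite eI scalerDr; exact: majorizedD.
- exact: nneg_coefsD.
move=> w v; rewrite eR eI; apply: real_CR_D (Cp w v) (Cq w v) => v';
  [exact: majorized_derivable Rp _ _|exact: majorized_derivable Ip _ _|
   exact: majorized_derivable Rq _ _|exact: majorized_derivable Iq _ _].
Qed.

Lemma holo_majorizedM p q A B : holo_majorized p A -> holo_majorized q B ->
  holo_majorized (fun w => p w * q w) (A * B).
Proof.
move=> [Rp Ip A0 Cp] [Rq Iq B0 Cq].
pose a w := complex.Re (p w); pose b w := complex.Im (p w).
pose c w := complex.Re (q w); pose d w := complex.Im (q w).
have eR : (fun w => complex.Re (p w * q w)) = a * c + cst (-1) * (b * d).
  apply/funext => w; rewrite !fctE /a /b /c /d; case: (p w); case: (q w) => *.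
  by rewrite mulN1r.
have eI : (fun w => complex.Im (p w * q w)) = a * d + b * c.
  by apply/funext => w; rewrite !fctE /a /b /c /d; case: (p w); case: (q w).
have eA : 2^-1 *: (A * B) =
    (2^-1 *: A) * (2^-1 *: B) + (2^-1 *: A) * (2^-1 *: B).
  rewrite -scalerAl -scalerAr scalerA -scalerDl; congr (_ *: _).
  by field.
have eA' : 2^-1 *: (A * B) =
    (2^-1 *: A) * (2^-1 *: B) + 1%:P * ((2^-1 *: A) * (2^-1 *: B)).
  by rewrite mul1r.
split.
- move=> k; rewrite eR eA'; apply: majorizedD; first exact: majorizedM.
  apply: majorizedM; first by apply: majorized_cst; rewrite normrN1.
  exact: majorizedM.
- by move=> k; rewrite eI eA; apply: majorizedD; exact: majorizedM.
- exact: nneg_coefsM.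
have eR' : (fun w => complex.Re (p w * q w)) = a * c - b * d.
  by rewrite eR; apply/funext => w; rewrite !fctE mulN1r.
move=> w v; rewrite eR' eI; apply: real_CR_M (Cp w v) (Cq w v) => v';
  [exact: majorized_derivable Rp _ _|exact: majorized_derivable Ip _ _|
   exact: majorized_derivable Rq _ _|exact: majorized_derivable Iq _ _].
Qed.

Definition zrow (w : P) : 'rV[R[i]]_n := \row_j (w.1 0 j +i* w.2 0 j).

Lemma norm_coord_le (a : 'rV[R]_n) j : `|a 0 j| <= `|a|.
Proof.
rewrite [leRHS]/Num.Def.normr /= mx_normrE.
exact: (le_bigmax _ (fun ij : 'I_1 * 'I_n => `|a ij.1 ij.2|) (0, j)).
Qed.

Lemma norm_fst_le (w : P) : `|w.1| <= `|w|.
Proof. by rewrite [leRHS]prod_normE le_max lexx. Qed.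

Lemma norm_snd_le (w : P) : `|w.2| <= `|w|.
Proof. by rewrite [leRHS]prod_normE le_max lexx orbT. Qed.

Lemma holo_majorized_coord j :
  holo_majorized (fun w => zrow w 0 j) (2 *: 'X).
Proof.
have e : 2^-1 *: (2 *: 'X : {poly R}) = 'X.
  by rewrite scalerA mulVf ?scale1r // pnatr_eq0.
have eR : (fun w => complex.Re (zrow w 0 j)) = (fun w => w.1 0 j).
  by apply/funext => w; rewrite mxE.
have eI : (fun w => complex.Im (zrow w 0 j)) = (fun w => w.2 0 j).
  by apply/funext => w; rewrite mxE.
have l1 : linear (fun w : P => w.1 0 j) by move=> k u v; rewrite /= !mxE.
have l2 : linear (fun w : P => w.2 0 j) by move=> k u v; rewrite /= !mxE.
split; rewrite ?e.
- move=> k; rewrite eR; apply: (majorized_linear fdP) => // h.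
  exact: le_trans (norm_coord_le _ _) (norm_fst_le _).
- move=> k; rewrite eI; apply: (majorized_linear fdP) => // h.
  exact: le_trans (norm_coord_le _ _) (norm_snd_le _).
- by apply: nneg_coefsZ => //; exact: nneg_coefsX.
- move=> w v; rewrite eR eI.
  rewrite !(derive_linear _ _ fdP l1) !(derive_linear _ _ fdP l2) /=.
  by split=> //; rewrite mxE oppr0.
Qed.

Lemma holo_majorizedX p A k : holo_majorized p A ->
  holo_majorized (fun w => p w ^+ k) (A ^+ k * 2%:P).
Proof.
move=> Hp; elim: k => [|k IH].
  have := holo_majorized_cst 1; rewrite Normc.normc1 mulr1 mul1r.
  by congr holo_majorized.
rewrite exprS -mulrA (_ : (fun w => _) = (fun w => p w * p w ^+ k)).
  exact: holo_majorizedM.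
by apply/funext => w; rewrite exprS.
Qed.

Lemma holo_majorized_prod (I : Type) (r : seq I) (p : I -> P -> R[i])
    (A : I -> {poly R}) :
  (forall i, holo_majorized (p i) (A i)) ->
  holo_majorized (fun w => \prod_(i <- r) p i w) ((\prod_(i <- r) A i) * 2%:P).
Proof.
move=> Hp; elim: r => [|i r IH].
  have := holo_majorized_cst 1; rewrite Normc.normc1 mulr1 big_nil mul1r.
  rewrite (_ : (fun w : P => \prod_(i <- [::]) p i w) = cst 1) //.
  by apply/funext => w; rewrite big_nil.
rewrite big_cons -mulrA.
rewrite (_ : (fun w : P => _) = (fun w => p i w * \prod_(j <- r) p j w)).
  exact: holo_majorizedM.
by apply/funext => w; rewrite big_cons.
Qed.

Lemma holo_majorized_sum (I : Type) (r : seq I) (Q : pred I) (p : I -> P -> R[i])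
    (A : I -> {poly R}) :
  (forall i, holo_majorized (p i) (A i)) ->
  holo_majorized (fun w => \sum_(i <- r | Q i) p i w) (\sum_(i <- r | Q i) A i).
Proof.
move=> Hp; elim: r => [|i r IH].
  have := holo_majorized_cst 0; rewrite Normc.normc0 mulr0 big_nil.
  rewrite (_ : (fun w : P => \sum_(i <- [::] | Q i) p i w) = cst 0) //.
  by apply/funext => w; rewrite big_nil.
rewrite big_cons; case: ifP => Qi; last first.
  rewrite (_ : (fun w : P => _) = (fun w => \sum_(j <- r | Q j) p j w)) //.
  by apply/funext => w; rewrite big_cons Qi.
rewrite (_ : (fun w : P => _) = (fun w => p i w + \sum_(j <- r | Q j) p j w)).
  exact: holo_majorizedD.
by apply/funext => w; rewrite big_cons Qi.
Qed.

(** The constants 2 make up for the factors 1/2 in [holo_majorized]; only their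
    independence of [a] matters, see [term_majorantE]. *)
Definition term_majorant (c : R[i]) (a : 'I_n -> nat) : {poly R} :=
  (2 * Normc.normc c)%:P *
  ((\prod_i ((2 *: 'X) ^+ a i * 2%:P)) * 2%:P).

Lemma holo_majorized_term c a :
  holo_majorized (fun w => c * monomial (zrow w) a) (term_majorant c a).
Proof.
apply: (@holo_majorizedM (cst c)); first exact: holo_majorized_cst.
apply: (@holo_majorized_prod _ _ (fun i w => zrow w 0 i ^+ a i)) => i.
by apply: holo_majorizedX; exact: holo_majorized_coord.
Qed.

Lemma term_majorantE c a r : (term_majorant c a).[r] =
  2 ^+ n * 4 * (Normc.normc c * \prod_i (2 * r) ^+ a i).
Proof.
rewrite /term_majorant !hornerM !hornerC horner_prod.
under eq_bigr do rewrite hornerM hornerC horner_exp hornerZ hornerX.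
by rewrite big_split /= prodr_const card_ord; ring.
Qed.

End HolomorphicMajorants.

Section HolomorphicGerm.
Variables (R : realType) (n : nat) (H : 'rV[R[i]]_n -> R[i]).
Local Notation P := (phase R n).
Local Notation Re := complex.Re.
Local Notation Im := complex.Im.

Lemma norm_complexE (z : R[i]) : `|z| = (Normc.normc z)%:C.
Proof. by case: z. Qed.

Lemma Re_sum (I : Type) (r : seq I) (Q : pred I) (F : I -> R[i]) :
  Re (\sum_(i <- r | Q i) F i) = \sum_(i <- r | Q i) Re (F i).
Proof.
elim/big_rec2: _ => // i x y _ <-.
by case: (F i) => a b; case: (y) => a' b'.
Qed.

Lemma Im_sum (I : Type) (r : seq I) (Q : pred I) (F : I -> R[i]) :
  Im (\sum_(i <- r | Q i) F i) = \sum_(i <- r | Q i) Im (F i).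
Proof.
elim/big_rec2: _ => // i x y _ <-.
by case: (F i) => a b; case: (y) => a' b'.
Qed.

Let K : numFieldType := R[i].

Lemma cvg_Re_Im (s : nat -> K) (l : K) : s @ \oo --> l ->
  (fun m => Re (s m)) @ \oo --> Re l /\ (fun m => Im (s m)) @ \oo --> Im l.
Proof.
move=> /cvgrPdist_lt sl.
have key e : 0 < e -> \forall m \near \oo, Normc.normc (l - s m) < e.
  move=> e0; have e0' : 0 < e%:C by rewrite ltcR.
  apply: filterS (sl _ e0') => m.
  by rewrite norm_complexE ltcR.
split; apply/cvgrPdist_lt => e /key; apply: filterS => m; apply: le_lt_trans.
  by have := norm_Re_le (l - s m); case: l {sl key} => ? ?; case: (s m).
by have := norm_Im_le (l - s m); case: l {sl key} => ? ?; case: (s m).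
Qed.

Lemma zrow_lt (w : P) (rho : R) j :
  `|w| < rho -> Normc.normc (zrow w 0 j) < rho + rho.
Proof.
move=> wr; apply: le_lt_trans (normc_le _) _; rewrite mxE /=.
by apply: ltrD; apply: le_lt_trans wr; apply: le_trans (norm_coord_le _ _) _;
  [exact: norm_fst_le|exact: norm_snd_le].
Qed.

(** A complex coordinate [s_j + i t_j] has modulus less than [2 * rho] when
    [`|(s, t)| < rho], and up to a constant factor the majorants evaluate at
    [r] to the absolute series of [H] at the point with all coordinates [2 * r].  So [rho] is half of the
    radius on which the power series converges absolutely. *)
Lemma holomorphic_expansion : analytic_at H 0 ->
  exists (rho : R) (u : nat -> P -> R[i]) (A : nat -> {poly R}),
  [/\ 0 < rho, forall N, holo_majorized (u N) (A N),
      forall r, 0 <= r -> r < rho ->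
        bounded_series (fun N => (2^-1 *: A N).[r])
    & forall w, `|w| < rho ->
      series (fun N => Re (u N w)) @ \oo --> Re (H (zrow w)) /\
      series (fun N => Im (u N w)) @ \oo --> Im (H (zrow w))].
Proof.
move=> [c nc]; have /nbhs_ballP[e /= e0 He] := nc.
have [e_real Re0] : e = (Re e)%:C /\ 0 < Re e.
  move: e0; rewrite ltcE => /andP[/eqP Ie Re0]; split=> //.
  by move: Ie; case: (e) => a b /= ->.
have inball (h : 'rV[K]_n) :
    (forall j, Normc.normc (h 0 j) < Re e) -> ball (0 : 'rV[K]_n) e h.
  move=> hj; split=> // i j; rewrite (ord1 i) -ball_normE /= mxE sub0r normrN.
  by rewrite norm_complexE e_real ltcR.
pose rho := Re e / 2; have rho2 : rho + rho = Re e by rewrite -splitr.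
pose cN N (a : {ffun 'I_n -> 'I_N}) : 'I_n -> nat := fun i => a i.
pose u N (w : P) := \sum_(a : {ffun 'I_n -> 'I_N} | outer_shell a)
  c (cN N a) * monomial (zrow w) (cN N a).
pose A N := \sum_(a : {ffun 'I_n -> 'I_N} | outer_shell a)
  term_majorant (c (cN N a)) (cN N a).
exists rho, u, A; split.
- by rewrite divr_gt0.
- move=> N; apply: (@holo_majorized_sum R n _ _ _
    (fun (a : {ffun 'I_n -> 'I_N}) w => c (cN N a) * monomial (zrow w) (cN N a))
    (fun a => term_majorant (c (cN N a)) (cN N a))) => a.
  exact: holo_majorized_term.
- move=> r r0 rr; pose h : 'rV[R[i]]_n := const_mx (2 * r)%:C.
  have [M bM] : exists M : K, forall N : nat,
      \sum_(a : {ffun 'I_n -> 'I_N})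
         `|c (cN N a) * monomial h (cN N a)| <= M.
    have [] // := He h; apply: inball => j; rewrite mxE /= expr0n addr0 sqrtr_sqr.
    by rewrite ger0_norm ?mulr_ge0 // mulr_natl mulr2n -rho2 ltrD.
  pose G (a : 'I_n -> nat) := Normc.normc (c a) * \prod_i (2 * r) ^+ a i.
  have G0 a : 0 <= G a.
    rewrite mulr_ge0 ?prodr_ge0 // => [|i _]; last by rewrite exprn_ge0 ?mulr_ge0.
    exact: le_trans (norm_Re_le _).
  have normE a : `|c a * monomial h a| = (G a)%:C.
    rewrite normrM norm_complexE [RHS]rmorphM; congr (_ * _).
    rewrite (_ : monomial h a = (\prod_i (2 * r) ^+ a i)%:C).
      rewrite ger0_norm // ler0c prodr_ge0 // => i _.
      by rewrite exprn_ge0 ?mulr_ge0.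
    by rewrite /monomial rmorph_prod; apply: eq_bigr => i _; rewrite mxE rmorphXn.
  have bG N : \sum_(a : {ffun 'I_n -> 'I_N}) G (cN N a) <= Re M.
    have := bM N; under eq_bigr do rewrite normE.
    by rewrite -rmorph_sum lecE => /andP[].
  pose k : R := 2^-1 * (2 ^+ n * 4).
  have k0 : 0 <= k by rewrite mulr_ge0 ?invr_ge0 // mulr_ge0 // exprn_ge0.
  have M0 : 0 <= Re M by apply: le_trans (bG 0%N); apply: sumr_ge0.
  exists (k * Re M) => -[|m].
    by rewrite /series /= big_geq // mulr_ge0.
  rewrite /series /= big_mkord.
  rewrite (_ : \sum_(N < m.+1) _ = k * \sum_(N < m.+1)
      \sum_(a : {ffun 'I_n -> 'I_N} | outer_shell a) G (cN N a)).
    by rewrite (cube_shells m G) ler_wpM2l // bG.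
  rewrite mulr_sumr; apply: eq_bigr => N _.
  rewrite hornerZ horner_sum !mulr_sumr; apply: eq_bigr => a _.
  by rewrite term_majorantE; exact: mulrA.
- move=> w wr.
  have Pcvg : (fun N => \sum_(a : {ffun 'I_n -> 'I_N})
      c (cN N a) * monomial (zrow w) (cN N a) : K) @ \oo --> (H (zrow w) : K).
    have [] := He (zrow w).
      by apply: inball => j; rewrite -rho2; exact: zrow_lt.
    by rewrite add0r.
  have [cR cI] := cvg_Re_Im Pcvg.
  have e1 m : \sum_(N < m.+1) u N w = \sum_(a : {ffun 'I_n -> 'I_m})
      c (cN m a) * monomial (zrow w) (cN m a).
    exact: (cube_shells m (fun a => c a * monomial (zrow w) a)).
  split; rewrite -cvg_shiftS.
    rewrite (_ : [sequence _]_n = (fun m => Re (\sum_(a : {ffun 'I_n -> 'I_m})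
      c (cN m a) * monomial (zrow w) (cN m a)))) //.
    by apply/funext => m; rewrite /series /= big_mkord -Re_sum e1.
  rewrite (_ : [sequence _]_n = (fun m => Im (\sum_(a : {ffun 'I_n -> 'I_m})
      c (cN m a) * monomial (zrow w) (cN m a)))) //.
  by apply/funext => m; rewrite /series /= big_mkord -Im_sum e1.
Qed.

(** The Cauchy-Riemann equations hold for each term and pass to the termwise
    differentiated series. *)
Lemma holomorphic_smooth_CR : analytic_at H 0 ->
  exists2 rho : R, 0 < rho &
  [/\ smooth_on [set w : P | `|w| < rho] (fun w => Im (H (zrow w)))
    & forall v : 'rV[R]_n, 'D_(0, v) (fun w => Im (H (zrow w))) 0 =
        'D_(v, 0) (fun w => Re (H (zrow w))) 0].
Proof.
move=> /holomorphic_expansion[rho [u [A [rho0 hu bA cv]]]]; exists rho => //.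
have MR : majorized_series rho (fun N w => Re (u N w)) (fun N => 2^-1 *: A N).
  split=> // [k N|N]; first by have [] := hu N.
  by apply: nneg_coefsZ; [rewrite invr_ge0|have [] := hu N].
have MI : majorized_series rho (fun N w => Im (u N w)) (fun N => 2^-1 *: A N).
  split=> // [k N|N]; first by have [] := hu N.
  by apply: nneg_coefsZ; [rewrite invr_ge0|have [] := hu N].
have cR w : `|w| < rho -> series (fun N => Re (u N w)) @ \oo --> Re (H (zrow w)).
  by move=> /cv[].
have cI w : `|w| < rho -> series (fun N => Im (u N w)) @ \oo --> Im (H (zrow w)).
  by move=> /cv[].
have fdP := @finite_dim_phase R n.
split; first exact: (majorized_series_smooth fdP MI cI).
move=> v; have n0 : `|0 : P| < rho by rewrite normr0.
have [_ dR] := majorized_series_derive fdP MR cR n0.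
have [_ dI] := majorized_series_derive fdP MI cI n0.
have e : series (fun N => 'D_(0, v) (fun w => Im (u N w)) 0) =
         series (fun N => 'D_(v, 0) (fun w => Re (u N w)) 0).
  congr series; apply/funext => N; have [_ _ _ C] := hu N.
  exact: (C 0 v).1.
have := dI (0, v); rewrite e => c1.
exact: (cvg_unique _ c1 (dR (v, 0))).
Qed.

End HolomorphicGerm.

(** * The special case *)

Section SpecialCase.
Variables (R : realType) (n : nat) (S : 'rV[R]_n -> R).
Variable H : 'rV[R[i]]_n -> R[i].
Hypotheses (gS0 : grad S 0 = 0) (extH : holomorphic_extension S H).

Definition sp_F (w : phase R n) : R := sp_Q H w.1 w.2.

Let zrow_real (s : 'rV[R]_n) : zrow (s, 0) = map_mx (real_complex R) s.
Proof. by apply/rowP => j; rewrite !mxE. Qed.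

Let H_real : \forall s \near (0 : 'rV[R]_n), H (zrow (s, 0)) = (S s)%:C.
Proof. by case: extH => _; apply: filterS => s; rewrite zrow_real. Qed.

(** Only the vanishing of [F], [F_q] and [F_b] at 0 is left to check.  [Q] is
    zero on the real points, which settles the first two; for the third, the
    Cauchy-Riemann equations give [dQ/dt = dS] there. *)
Lemma sp_conclusion :
  [/\ Lagrangian_near (genfam_Lagrangian (G_sp H)) 0,
      image_germ_is_critical_values (sp_x H) (sp_singular H) 0
        (@tpi R n) (genfam_Lagrangian (G_sp H)) 0,
      Legendrian_near (genfam_Legendrian (G_sp H)) 0
    & image_germ_is_critical_values (fun w => (sp_x H w, sp_f H w))
        (sp_singular H) 0
        (@tpi_tilde R n) (genfam_Legendrian (G_sp H)) 0].
Proof.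
have an0 : analytic_at H 0 by case: extH => /nbhs_singleton.
have [rho rho0 [CF CR]] := holomorphic_smooth_CR an0.
pose U := [set w : phase R n | `|w| < rho].
have oU : open U := @open_norm_lt R _ rho.
have U0 : U 0 by rewrite /U /= normr0.
have {}CF : smooth_on U sp_F by exact: CF.
have {}CR v : 'D_(0, v) sp_F 0 = 'D_(v, 0) (fun w => complex.Re (H (zrow w))) 0.
  exact: CR.
have F0 : sp_F 0 = 0.
  by have := nbhs_singleton H_real; rewrite /sp_F /sp_Q => /= ->.
have gq0 : grad_q sp_F 0 = 0.
  apply/rowP => i; rewrite mxE [RHS]mxE.
  rewrite -(partial_fst sp_F 0 0 (basis_vec R i)).1.
  rewrite (near_eq_derive (g := cst 0)) ?derive_cst //.
  by apply: filterS H_real => s Hs; rewrite /sp_F /sp_Q /= Hs.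
have gb0 : grad_b sp_F 0 = 0.
  apply/rowP => i; rewrite mxE CR.
  rewrite -(partial_fst (fun w => complex.Re (H (zrow w))) 0 0 (basis_vec R i)).1.
  rewrite (near_eq_derive (g := S)).
    by have := congr1 (fun a : 'rV[R]_n => a 0 i) gS0; rewrite mxE.
  by apply: filterS H_real => s ->.
have xE w : sp_x H w = (w.1, grad_b sp_F w).
  by rewrite /sp_x (surjective_pairing w) -grad_bE.
have fE w : sp_f H w = graph_z sp_F w.
  by rewrite /sp_f /graph_z (surjective_pairing w) -grad_bE.
rewrite -[G_sp H]/(family sp_F).
have -> : sp_x H = (fun w => (w.1, grad_b sp_F w)) by apply/funext.
have -> : sp_f H = graph_z sp_F by apply/funext.
split.
- exact: (family_Lagrangian_near oU).
- exact: (family_Lagrangian_germ oU).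
- exact: (family_Legendrian_near oU).
- exact: (family_Legendrian_germ oU).
Qed.

End SpecialCase.

(** * Critical values and on-shell germs *)

Theorem theorem1p1 (R : realType) (n : nat) (S : 'rV[R]_n -> R) :
  grad S 0 = 0 ->
  (smooth_near 0 S ->
    [/\ Lagrangian_near (genfam_Lagrangian (G_cc S)) 0,
        image_germ_is_critical_values (cc_x S) (cc_singular S) 0
          (@tpi R n) (genfam_Lagrangian (G_cc S)) 0,
        Legendrian_near (genfam_Legendrian (G_cc S)) 0,
        (exists f, cc_height S f)
      & forall f, cc_height S f ->
        image_germ_is_critical_values (fun w => (cc_x S w, f w))
          (cc_singular S) 0
          (@tpi_tilde R n) (genfam_Legendrian (G_cc S)) 0]) /\
  (analytic_near S 0 ->
   forall H : 'rV[R[i]]_n -> R[i], holomorphic_extension S H ->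
    [/\ Lagrangian_near (genfam_Lagrangian (G_sp H)) 0,
        image_germ_is_critical_values (sp_x H) (sp_singular H) 0
          (@tpi R n) (genfam_Lagrangian (G_sp H)) 0,
        Legendrian_near (genfam_Legendrian (G_sp H)) 0
      & image_germ_is_critical_values (fun w => (sp_x H w, sp_f H w))
          (sp_singular H) 0
          (@tpi_tilde R n) (genfam_Legendrian (G_sp H)) 0]).
Proof.
move=> gS0; split=> [[U [oU U0] CS]|_ H extH]; first exact: (cc_conclusion oU).
exact: (sp_conclusion gS0 extH).
Qed.
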